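(* For $q$ odd and $|u|<1/q$, we have the generating functions (1) for each choice of sign, $$\sum_{n\ge 0}\frac{i(\mathrm{SO}^{\pm}(2n,q))}{|\mathrm{O}^{\pm}(2n,q)|}q^{n^2}u^n=\frac12\left[\frac{\prod_{i\ge 1}(1+u/q^{2(i-1)})^2}{\prod_{i\ge 1}(1-u^2/q^{2(i-2)})}\pm\frac{\prod_{i\ge 1}(1+u/q^{2i-1})^2}{\prod_{i\ge 1}(1-u^2/q^{2(i-1)})}\right],$$ (2) $$\sum_{n\ge 0}\frac{i(\mathrm{SO}(2n+1,q))}{|\mathrm{O}(2n+1,q)|}q^{n^2}u^n=\frac12\,\frac{1}{1-u}\,\frac{\prod_{i\ge 1}(1+u/q^{2i})^2}{\prod_{i\ge 1}(1-u^2/q^{2i})}.$$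
   Context: For $q$ an odd prime power and $\delta$ a fixed nonsquare in $\mathbb{F}_q^{\times}$: $\mathrm{O}^{+}(2n,q)$ is the isometry group on $\mathbb{F}_q^{2n}$ of the quadratic form $x_1x_2+x_3x_4+\cdots+x_{2n-1}x_{2n}$; for $n\ge1$, $\mathrm{O}^{-}(2n,q)$ is that of $x_1x_2+\cdots+x_{2n-3}x_{2n-2}+x_{2n-1}^2-\delta x_{2n}^2$; $\mathrm{O}(2n+1,q)$ is that of $x_1x_2+\cdots+x_{2n-1}x_{2n}+x_{2n+1}^2$ on $\mathbb{F}_q^{2n+1}$ (replacing $x_{2n+1}^2$ by $\delta x_{2n+1}^2$ gives an isomorphic group). $\mathrm{SO}$ denotes the subgroup of determinant $1$ elements. $i(X)$ denotes the number of $g\in X$ with $g^2=1$ (the identity is counted). Conventions: $\mathrm{O}^{+}(0,q)$ and $\mathrm{SO}^{+}(0,q)$ are trivial, so $|\mathrm{O}^{+}(0,q)|=1$ and $i(\mathrm{SO}^+(0,q))=1$; and $1/|\mathrm{O}^{-}(0,q)|=0$, so the $n=0$ term of the series with sign $-$ is $0$. *)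

(* Defs.v *)
From HB Require Import structures.
From mathcomp Require Import all_boot all_order all_algebra.
From mathcomp Require Import all_classical all_reals all_analysis.
From mathcomp Require Export complex.
Set Implicit Arguments.
Unset Strict Implicit.
Unset Printing Implicit Defensive.
Import Order.TTheory GRing.Theory Num.Theory.
Import numFieldNormedType.Exports.
Local Open Scope classical_set_scope.
Local Open Scope ring_scope.

Section Forms.
Variable F : finFieldType.

(* The coordinate of [v] of index [k], counted from 0; it is 0 when [k >= m],
   which does not happen in the forms below (except in [form_minus] for
   [n = 0], a value that is never used). *)
Definition coordinate (m : nat) (v : 'rV[F]_m) (k : nat) : F :=
  if insub k is Some i then v 0 i else 0.

Definition hyperbolic_sum (m n : nat) (v : 'rV[F]_m) : F :=
  \sum_(i < n) coordinate v (2 * i)%N * coordinate v (2 * i).+1.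

Definition form_plus (n : nat) (v : 'rV[F]_(2 * n)) : F :=
  hyperbolic_sum n v.

Definition form_minus (delta : F) (n : nat) (v : 'rV[F]_(2 * n)) : F :=
  hyperbolic_sum n.-1 v + coordinate v (2 * n.-1)%N ^+ 2
    - delta * coordinate v (2 * n.-1).+1 ^+ 2.

Definition form_odd (n : nat) (v : 'rV[F]_((2 * n).+1)) : F :=
  hyperbolic_sum n v + coordinate v (2 * n)%N ^+ 2.

(* Matrices act on row vectors from the right. The groups are taken as sets of
   invertible matrices, not inside ['GL_m], because the latter does not cover
   m = 0; here ['M_0] has exactly one element, which is invertible. *)
Definition isometries (m : nat) (Q : 'rV[F]_m -> F) : {set 'M[F]_m} :=
  [set g : 'M[F]_m | (g \in unitmx) && [forall v, Q (v *m g) == Q v]].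

Definition det1_part (m : nat) (X : {set 'M[F]_m}) : {set 'M[F]_m} :=
  [set g in X | \det g == 1].

Definition num_involutions (m : nat) (X : {set 'M[F]_m}) : nat :=
  #|[set g in X | g *m g == 1%:M]|.

Variant sign := Plus | Minus.

Definition O_even (s : sign) (delta : F) (n : nat) : {set 'M[F]_(2 * n)} :=
  match s with
  | Plus => isometries (@form_plus n)
  | Minus => isometries (@form_minus delta n)
  end.

Definition SO_even (s : sign) (delta : F) (n : nat) : {set 'M[F]_(2 * n)} :=
  det1_part (O_even s delta n).

Definition O_odd (n : nat) : {set 'M[F]_((2 * n).+1)} :=
  isometries (@form_odd n).

Definition SO_odd (n : nat) : {set 'M[F]_((2 * n).+1)} := det1_part (O_odd n).

End Forms.

Section Series.
Variable C : numFieldType.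

Definition sums_to (a : nat -> C) (l : C) : Prop := series a @ \oo --> l.

(* Infinite products are indexed from 1. *)
Definition infprod (a : nat -> C) : C :=
  limn (fun N : nat => \prod_(1 <= i < N.+1) a i).

(* Convergence of an infinite product requires a nonzero limit. *)
Definition infprod_cvg (a : nat -> C) : Prop :=
  cvgn (fun N : nat => \prod_(1 <= i < N.+1) a i) /\ infprod a != 0.

Definition sign_val (s : sign) : C :=
  match s with Plus => 1 | Minus => -1 end.

Variable F : finFieldType.

(* 1 / |O^s(2n, q)|, with the convention 1 / |O^-(0, q)| = 0. *)
Definition inv_card_O_even (s : sign) (delta : F) (n : nat) : C :=
  match s, n with
  | Minus, 0%N => 0
  | _, _ => (#|O_even s delta n|%:R)^-1
  end.

Definition even_term (s : sign) (delta : F) (u : C) (n : nat) : C :=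
  (num_involutions (SO_even s delta n))%:R * inv_card_O_even s delta n
    * (#|F|%:R) ^+ (n ^ 2) * u ^+ n.

Definition odd_term (u : C) (n : nat) : C :=
  (num_involutions (SO_odd F n))%:R / #|O_odd F n|%:R
    * (#|F|%:R) ^+ (n ^ 2) * u ^+ n.

End Series.

(* Main.v *)
Require Import Defs.
From HB Require Import structures.
From mathcomp Require Import all_boot all_order all_algebra fingroup cyclic.
From mathcomp Require Import ring lra zify.

                                                                              
                                                                              
                                                                           
                                                                     
                                                                       
                                                                                   
                                                                              
                                                                            
                                                              

                                                                                   
                  
                                                                            
                                                                                 
                                     
                                                                              

Set Implicit Arguments.
Unset Strict Implicit.
Unset Printing Implicit Defensive.
Import Order.TTheory GRing.Theory Num.Theory FinRing.Theory.
Local Open Scope ring_scope.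

                                                                     

(** The involutions are obtained by a double count over a congruence class of forms. By
    [congruent_classification], nondegenerate symmetric matrices of one size over [F] are congruent
    as soon as the product of their determinants is a square. So the class of S has |GL_m| / |O(S)|
    elements, and i(SO(S)) / |O(S)| is the number of pairs (T, g), T in the class and g an
    involution of determinant 1 preserving T, divided by |GL_m|. Now fix g first. It is conjugate to
    diag(-1_j, 1_{m-j}) with j even, there are |GL_m| / (|GL_j| |GL_{m-j}|) such g, and the forms it
    preserves are the orthogonal sums of a form on each eigenspace. The discriminant condition is
    detected by (1 + chi)/2, where chi is the quadratic character; multiplicativity of chi separates
    the two summands ([special_involutions_ratio]). What remains are the sums of 1 and of chi(det)
    over invertible symmetric matrices. Schur complements give them a recurrence ([sym_sum_rec]),
    solved in [sym_count_ratio], [sym_qchar_ratio] and [sym_qchar_odd].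

    Put p = q^-2 and (p)_k = (1 - p)...(1 - p^k). The terms of both series become homogeneous parts
    of theta(A, B) = sum over k, l of A^k B^l q^(-(k-l)^2) / ((p)_k (p)_l): half of theta(uq, uq) +
    sg theta(u, u) in even dimension, with sg = chi((-1)^n det S) ([even_termE]), and half of
    theta(uq, u/q) in odd dimension, where the character sums vanish ([odd_termE]).

    Weighting the terms of theta by p^k, p^l and p^(k+l) gives three linear relations, whose
    elimination yields theta(A, B) (1 - AB)(1 - ABp) = (1 + A/q)(1 + B/q) theta(pA, pB). Iterating,
    with theta(p^N A, p^N B) tending to 1, gives theta(A, B) as the product of the (1 + A p^i/q)(1 +
    B p^i/q) divided by that of the (1 - AB p^i), over i >= 0 ([theta_product]). The stated formulas
    are its three specialisations. *)

(** * Squares in a finite field of odd order *)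

Section QuadraticCharacter.
Variable F : finFieldType.
Hypothesis odd_q : odd #|F|.

(** If 2 = 0, the additive order of 1 divides both 2 and the odd number [#|F|], so it is 1, which is
    absurd. *)
Lemma odd_card_two_neq0 : (2 : F) != 0.
Proof.
apply/negP => /eqP two0.
have o2 : (#[(1 : F)%R]%g %| 2)%N by rewrite order_dvdn zmodXgE two0.
have oq : (#[(1 : F)%R]%g %| #|F|)%N by rewrite -cardsT order_dvdG ?inE.
have o1 : #[(1 : F)%R]%g = 1%N.
  have := dvdn_odd oq odd_q; have := dvdn_leq (isT : 0 < 2)%N o2.
  by case: #[_]%g (order_gt0 (1 : F)%R) => [|[|[|]]].
by move/eqP: (expg_order (1 : F)%R); rewrite o1 zmodXgE mulr1n; apply/negP; exact: oner_neq0.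
Qed.

Definition square (x : F) : bool := [exists y, y ^+ 2 == x].

Definition squares : {set F} := [set y ^+ 2 | y in [set~ 0 : F]].

Lemma squareP x : reflect (exists y, x = y ^+ 2) (square x).
Proof. by apply: (iffP existsP) => -[y] => [/eqP <-|->]; exists y. Qed.

Lemma in_squares x : (x \in squares) = (x != 0) && square x.
Proof.
apply/imsetP/andP => [[y]|[x0 /squareP [y xy]]].
  by rewrite !inE => y0 ->; rewrite expf_neq0 //; split=> //; apply/squareP; exists y.
by exists y => //; rewrite !inE; apply: contraNneq x0; rewrite xy => ->; rewrite expr0n.
Qed.

(** Squaring is at most two-to-one on nonzero elements, its fibres being contained in sets {y,
    -y}. *)
Lemma card_squares : (#|F| <= (2 * #|squares|).+1)%N.
Proof.
have -> : #|F| = #|[set~ 0 : F]|.+1.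
  by rewrite cardsC1 prednK // (cardD1 0).
rewrite ltnS -sum1_card (partition_big (fun y => y ^+ 2) (mem squares)) /=; last first.
  by move=> y y0; apply: imset_f.
rewrite mulnC -sum_nat_const; apply: leq_sum => z /imsetP [y _ ->].
rewrite sum1_card; apply: leq_trans (_ : #|[set y; - y]| <= 2)%N.
  apply: subset_leq_card; apply/fintype.subsetP => x.
  by rewrite unfold_in => /andP[_]; rewrite !inE eqf_sqr.
by rewrite cards2; case: (_ != _).
Qed.

(** The coset of the nonzero squares by a is disjoint from them, and by counting the two fill all
    nonzero elements. So b = a y^2 for some y, and ab = (ay)^2. *)
Lemma nonsquareM a b : ~~ square a -> ~~ square b -> square (a * b).
Proof.
move=> na nb.
have a0 : a != 0 by apply: contraNneq na => ->; apply/squareP; exists 0; rewrite expr0n.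
have b0 : b != 0 by apply: contraNneq nb => ->; apply/squareP; exists 0; rewrite expr0n.
pose aS := [set a * z | z in squares].
have aSdisj : [disjoint squares & aS].
  rewrite disjoint_sym disjoints_subset; apply/fintype.subsetP => _ /imsetP [z + ->].
  rewrite !inE !in_squares => /andP[z0 /squareP [y zy]].
  rewrite mulf_neq0 //=; apply: contra na => /squareP [t atz]; apply/squareP; exists (t / y).
  have y0 : y != 0 by apply: contraNneq z0; rewrite zy => ->; rewrite expr0n.
  by rewrite expr_div_n -atz zy mulfK // expf_neq0.
have cU : (#|[set~ (0%R : F)]| <= #|squares :|: aS|)%N.
  rewrite cardsU disjoint_setI0 // cards0 subn0 (card_imset _ (mulfI a0)).
  rewrite addnn -mul2n -ltnS; apply: leq_trans card_squares.
  by rewrite cardsC1 prednK // (cardD1 0).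
have UT : squares :|: aS = [set~ 0].
  apply/eqP; rewrite eqEcard cU andbT; apply/fintype.subsetP => x.
  rewrite !inE in_squares => /orP [/andP[]//|/imsetP [z]].
  by rewrite in_squares => /andP [z0 _] ->; rewrite mulf_neq0.
have : b \in squares :|: aS by rewrite UT !inE.
rewrite !inE in_squares (negPf nb) andbF /= => /imsetP [z].
rewrite in_squares => /andP[_ /squareP [y ->]] ->.
by apply/squareP; exists (a * y); ring.
Qed.

(** Pigeonhole: the values a x^2 and the values 1 - b y^2 each occupy more than half of the
    field. *)
Lemma two_squares_repr1 (a b : F) : a != 0 -> b != 0 ->
  exists x y : F, a * x ^+ 2 + b * y ^+ 2 = 1.
Proof.
move=> a0 b0.
pose S0 := 0 |: squares.
have cS0 : (#|F| < 2 * #|S0|)%N.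
  rewrite cardsU1 in_squares eqxx /= mulnDr muln1 add2n ltnS.
  exact: card_squares.
have S0P z : z \in S0 -> exists y, z = y ^+ 2.
  rewrite !inE in_squares => /orP [/eqP ->|/andP[_ /squareP//]].
  by exists 0; rewrite expr0n.
pose A := [set a * z | z in S0]; pose B := [set 1 - b * z | z in S0].
have cA : #|A| = #|S0| by rewrite (card_imset _ (mulfI a0)).
have cB : #|B| = #|S0|.
  by rewrite card_imset // => z t /addrI /oppr_inj; exact: mulfI.
have : A :&: B != finset.set0.
  rewrite -cards_eq0 -lt0n -(ltn_add2l #|A :|: B|) addn0 cardsUI cA cB addnn -mul2n.
  by apply: leq_ltn_trans cS0; apply: max_card.
case/set0Pn => _ /setIP [/imsetP [z /S0P [x ->] ->] /imsetP [t /S0P [y ->]]] e.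
by exists x, y; rewrite e subrK.
Qed.

End QuadraticCharacter.

(** * Character sums over determinants of symmetric matrices *)

Section SymmetricDeterminantSums.
Variables (F : finFieldType) (K : numFieldType).

Definition qchar (x : F) : K :=
  if x == 0 then 0 else if square x then 1 else -1.

(** The trivial multiplicative character extended by 0, the companion of [qchar] in the recurrence
    below. *)
Definition is_nonzero (x : F) : K := (x != 0)%:R.

Lemma qchar0 : qchar 0 = 0. Proof. by rewrite /qchar eqxx. Qed.

Lemma qchar_sqr x : x != 0 -> qchar (x ^+ 2) = 1.
Proof.
move=> x0; rewrite /qchar expf_eq0 (negPf x0) andbF.
by have -> : square (x ^+ 2) by apply/squareP; exists x.
Qed.

Lemma squareM (x y : F) : x != 0 -> square x -> square (x * y) = square y.
Proof.
move=> x0 /squareP [s xs].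
have s0 : s != 0 by apply: contraNneq x0; rewrite xs => ->; rewrite expr0n.
apply/squareP/squareP => -[t e]; [exists (t / s) | exists (s * t)].
  by rewrite expr_div_n -e xs mulrAC divff ?mul1r // expf_neq0.
by rewrite e xs exprMn.
Qed.

Lemma qcharM x y : qchar (x * y) = qchar x * qchar y.
Proof.
rewrite /qchar mulf_eq0; have [_|x0] := eqVneq x 0; first by rewrite mul0r.
have [_|y0] /= := eqVneq y 0; first by rewrite mulr0.
have [sx|nx] := boolP (square x); first by rewrite squareM // mul1r.
have [sy|ny] := boolP (square y); first by rewrite mulrC squareM // (negPf nx) mulr1.
by rewrite nonsquareM // mulrNN mulr1.
Qed.

Lemma is_nonzero0 : is_nonzero 0 = 0. Proof. by rewrite /is_nonzero eqxx. Qed.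

Lemma is_nonzero_sqr x : x != 0 -> is_nonzero (x ^+ 2) = 1.
Proof. by move=> x0; rewrite /is_nonzero expf_neq0. Qed.

Lemma is_nonzeroM x y : is_nonzero (x * y) = is_nonzero x * is_nonzero y.
Proof. by rewrite /is_nonzero mulf_eq0 negb_or -natrM mulnb. Qed.

Lemma sum_is_nonzero : \sum_x is_nonzero x = #|F|%:R - 1.
Proof.
have -> : #|F|%:R = \sum_(x : F) 1 :> K by rewrite sumr_const.
rewrite (bigD1 (0 : F)) //= [in RHS](bigD1 (0 : F)) //= is_nonzero0 add0r.
by rewrite [RHS]addrAC subrr add0r; apply: eq_bigr => x x0; rewrite /is_nonzero x0.
Qed.

(** Multiplication by the nonsquare [delta] permutes the field and negates the character, so the sum
    equals its opposite. *)
Lemma sum_qchar (delta : F) : (forall x : F, x ^+ 2 != delta) ->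
  \sum_x qchar x = 0.
Proof.
move=> nd; have d0 : delta != 0 by rewrite eq_sym; have := nd 0; rewrite expr0n.
have qd : qchar delta = -1.
  by rewrite /qchar (negPf d0); case: squareP => // -[y e]; have := nd y; rewrite e eqxx.
have : \sum_x qchar x = - \sum_x qchar x.
  rewrite [LHS](reindex_inj (mulfI d0)) -sumrN; apply: eq_bigr => x _.
  by rewrite qcharM qd mulN1r.
move/eqP; rewrite -addr_eq0 -mulr2n mulrn_eq0 /= => /eqP //.
Qed.

Variable f : F -> K.
Hypotheses (fM : forall x y, f (x * y) = f x * f y) (f0 : f 0 = 0)
  (f_sqr : forall x, x != 0 -> f (x ^+ 2) = 1).

                                                                              
                                                                           
                           
(** For [is_nonzero] this counts the invertible symmetric matrices; for [qchar] it is the excess of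
    square over nonsquare determinants. Triviality of f on nonzero squares makes the summand a
    congruence invariant. *)
Definition sym_sum m : K := \sum_(S : 'M[F]_m | S^T == S) f (\det S).

Lemma weight1 : f 1 = 1.
Proof. by rewrite -[1](expr1n _ 2) f_sqr // oner_neq0. Qed.

Lemma sum_sym_block n (g : 'M[F]_(1 + n) -> K) :
  \sum_(S | S^T == S) g S =
  \sum_(a : F) \sum_(b : 'rV[F]_n) \sum_(C : 'M[F]_n | C^T == C)
    g (block_mx a%:M b b^T C).
Proof.
rewrite pair_big_dep /= pair_big_dep /=.
rewrite (reindex (fun t : F * 'rV[F]_n * 'M[F]_n =>
   block_mx t.1.1%:M t.1.2 t.1.2^T t.2)) /=.
  apply: eq_bigl => -[[a b] C] /=.
  rewrite tr_block_mx tr_scalar_mx trmxK; apply/eqP/eqP => [|->//].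
  by case/eq_block_mx.
exists (fun S : 'M_(1 + n) => (ulsubmx S 0 0, ursubmx S, drsubmx S)) => [[[a b] C] _|S].
  by rewrite block_mxKul block_mxKur block_mxKdr mxE eqxx mulr1n.
rewrite inE => /eqP sS /=; rewrite trmx_ursub sS.
by rewrite -mx11_scalar submxK.
Qed.

Lemma det_block_schur n (b : 'rV[F]_n) (c : 'cV[F]_n) (C : 'M[F]_n) :
  \det (block_mx 1%:M b c C) = \det (C - c *m b).
Proof.
have : block_mx 1%:M 0 (- c) 1%:M *m block_mx 1%:M b c C
       = block_mx 1%:M b 0 (C - c *m b).
  by rewrite mulmx_block !mul0mx !mul1mx !mulNmx !mulmx1 !addr0 addNr addrC.
move/(congr1 determinant); rewrite det_mulmx det_lblock det_ublock.
by rewrite !det1 !mul1r.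
Qed.

Lemma det_block_schur_scalar n a (b : 'rV[F]_n) (C : 'M[F]_n) : a != 0 ->
  \det (block_mx a%:M b b^T C) = a * \det (C - a^-1 *: (b^T *m b)).
Proof.
move=> a0.
have -> : block_mx a%:M b b^T C
        = block_mx a%:M 0 0 1%:M *m block_mx 1%:M (a^-1 *: b) b^T C.
  rewrite mulmx_block !mul0mx !mul1mx !addr0 !add0r mulmx1 mul_scalar_mx.
  by rewrite scalerA divff // scale1r.
by rewrite det_mulmx det_ublock det1 mulr1 det_scalar1 det_block_schur -scalemxAr.
Qed.

Lemma sym_shift n (b : 'rV[F]_n) (a : F) (h : 'M[F]_n -> K) :
  \sum_(C | C^T == C) h (C - a *: (b^T *m b)) = \sum_(C | C^T == C) h C.
Proof.
rewrite [RHS](reindex_inj (addIr (- (a *: (b^T *m b))))) /=; apply: eq_bigl => C.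
rewrite linearB linearZ /= trmx_mul trmxK.
by rewrite (inj_eq (addIr _)).
Qed.

(** With an invertible corner a, the determinant is a times that of the Schur complement, and
    translation by the rank-one term permutes the symmetric C. *)
Lemma sym_sum_pivot n a : a != 0 ->
  \sum_(b : 'rV[F]_n) \sum_(C : 'M[F]_n | C^T == C) f (\det (block_mx a%:M b b^T C))
  = f a * #|F|%:R ^+ n * sym_sum n.
Proof.
move=> a0; under eq_bigr => b _.
  under eq_bigr => C _ do rewrite det_block_schur_scalar // fM.
  rewrite -mulr_sumr (sym_shift b a^-1 (fun C => f (\det C))) -/(sym_sum n).
  over.
by rewrite sumr_const card_mx mul1n -[LHS]mulr_natr natrX mulrAC.
Qed.

(** With a zero corner and b nonzero, a congruence moves b to the first unit vector; a hyperbolic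
    plane then splits off with determinant -1, leaving the first row of C free. *)
Lemma sym_sum_nopivot m (b : 'rV[F]_(1 + m)) : b != 0 ->
  \sum_(C : 'M[F]_(1 + m) | C^T == C) f (\det (block_mx (0 : 'M_1) b b^T C))
  = f (-1) * #|F|%:R ^+ (1 + m) * sym_sum m.
Proof.
move=> b0; pose e : 'rV[F]_(1 + m) := row_mx 1%:M 0.
have rk_b : \rank b = 1%N by apply/eqP; rewrite rank_rV b0.
have [h uh bh] : exists2 h : 'M[F]_(1 + m), h \in unitmx & b *m h = e.
  have : row_free b by rewrite /row_free rk_b.
  move=> /row_freeP [c bc].
  have bce : b *m (c *m e) = e by rewrite mulmxA bc mul1mx.
  have [|h uh bh] := @complete_unitmx _ 1 (1 + m) b (c *m e).
    rewrite bce rk_b rank_rV; suff -> : e != 0 by [].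
    apply/negP => /eqP/(congr1 (fun M : 'rV_(1 + m) => lsubmx M 0 0)).
    by rewrite row_mxKl !mxE eqxx; apply/eqP; rewrite oner_neq0.
  by exists h => //; rewrite -bh bce.
have hT_unit : h^T \in unitmx by rewrite unitmx_tr.
have dh : \det h != 0 by rewrite unitmxE unitfE in uh.
(* The congruence by diag(1, h) multiplies the determinant by a nonzero square, which f does not
   see. *)
transitivity (\sum_(C : 'M[F]_(1 + m) | C^T == C) f (\det (block_mx (0 : 'M_1) e e^T C))).
  rewrite [RHS](reindex (fun C => h^T *m C *m h)) /=; last first.
    exists (fun C => invmx h^T *m C *m invmx h) => C _.
      by rewrite !mulmxA mulVmx // mul1mx mulmxK.
    by rewrite !mulmxA mulmxV // mul1mx mulmxKV.
  apply: eq_big => [C|C _].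
    rewrite !trmx_mul trmxK mulmxA.
    apply/eqP/eqP => [->//|/(congr1 (fun M => invmx h^T *m M *m invmx h))].
    by rewrite !mulmxA !mulVmx // !mul1mx !mulmxK.
  have -> : block_mx 0 e e^T (h^T *m C *m h)
     = block_mx (1%:M : 'M_1) 0 0 h^T *m block_mx 0 b b^T C *m block_mx (1%:M : 'M_1) 0 0 h.
    rewrite !mulmx_block !mul0mx !mulmx0 !addr0 !add0r !mul1mx !mulmx1.
    by rewrite -trmx_mul bh.
  rewrite !det_mulmx !det_ublock !det1 !mul1r det_tr mulrC mulrA -expr2 fM.
  by rewrite f_sqr // mul1r.
rewrite sum_sym_block.
                                                                        
(* Adding the second row to the first puts a 1 in the corner; the Schur complement is then block
   lower triangular with diagonal -1, E. *)
have detE (c : F) (d : 'rV[F]_m) (E : 'M[F]_m) :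
    \det (block_mx (0 : 'M_1) e e^T (block_mx c%:M d d^T E)) = - \det E.
  have : block_mx (1%:M : 'M_1) e 0 1%:M *m block_mx 0 e e^T (block_mx c%:M d d^T E)
     = block_mx 1%:M (e + row_mx c%:M d) e^T (block_mx c%:M d d^T E).
    rewrite mulmx_block !mul0mx !mul1mx !add0r /e tr_row_mx trmx0 trmx1 mul_row_col.
    by rewrite mul_row_block !mul0mx !mul1mx !addr0.
  move/(congr1 determinant); rewrite det_mulmx det_ublock !det1 !mul1r => ->.
  rewrite det_block_schur /e add_row_mx add0r tr_row_mx trmx1 trmx0 mul_col_row.
  rewrite !mul1mx !mul0mx opp_block_mx add_block_mx subrr !oppr0 !addr0.
  by rewrite opprD addrCA subrr addr0 det_lblock -scaleN1r detZ expr1 det1 mulr1 mulN1r.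
under eq_bigr => c _ do under eq_bigr => d _ do
  under eq_bigr => E _ do rewrite detE -mulN1r fM.
under eq_bigr => c _ do under eq_bigr => d _ do rewrite -mulr_sumr -/(sym_sum m).
rewrite !sumr_const card_mx mul1n -mulrnA -[in LHS]mulr_natr natrM natrX exprSr.
by rewrite mulrAC.
Qed.

(** The first term collects the matrices with nonzero corner, the second those with zero corner and
    one of the q^(m+1) - 1 nonzero rows b. A zero first row contributes f 0 = 0. *)
Lemma sym_sum_rec m :
  sym_sum m.+2 = (\sum_a f a) * #|F|%:R ^+ m.+1 * sym_sum m.+1
    + f (-1) * (#|F|%:R ^+ m.+1 - 1) * #|F|%:R ^+ m.+1 * sym_sum m.
Proof.
rewrite {1}/sym_sum -[m.+2]/(1 + (1 + m))%N sum_sym_block (bigD1 (0 : F)) //= addrC.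
congr (_ + _).
  rewrite (eq_bigr (fun a => f a * (#|F|%:R ^+ m.+1 * sym_sum m.+1))); last first.
    by move=> a a0; rewrite -[m.+1]/(1 + m)%N sym_sum_pivot // mulrA.
  by rewrite -mulr_suml [in RHS](bigD1 (0 : F)) //= f0 add0r mulrA.
rewrite (bigD1 (0 : 'rV_(1 + m))) //= big1 ?add0r; last first.
  move=> C _; rewrite trmx0 raddf0.
  by rewrite det_ublock det0 mul0r.
rewrite (eq_bigr (fun=> f (-1) * #|F|%:R ^+ (1 + m) * sym_sum m)); last first.
  by move=> b b0; rewrite -(sym_sum_nopivot b0) raddf0.
rewrite sumr_const -[#|_|]/(#|predC1 _|) cardC1 card_mx mul1n.
have q0 : (0 < #|F|)%N by apply/card_gt0P; exists 0.
rewrite -[LHS]mulr_natr -subn1 natrB ?expn_gt0 ?q0 //.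
rewrite natrX -[(1 + m)%N]/m.+1.
by rewrite mulrAC; congr (_ * _); rewrite mulrAC.
Qed.

Lemma sym_sum0 : sym_sum 0 = 1.
Proof.
rewrite /sym_sum (eq_bigl predT); last by move=> S; rewrite [S^T]flatmx0 [S]flatmx0 eqxx.
under eq_bigr => S _ do rewrite det_mx00 weight1.
by rewrite sumr_const card_mx.
Qed.

Lemma sym_sum1 : sym_sum 1 = \sum_a f a.
Proof.
rewrite /sym_sum (reindex (fun a : F => a%:M)) /=.
  by apply: eq_big => a; rewrite ?tr_scalar_mx ?eqxx // det_scalar1.
exists (fun S : 'M_1 => S 0 0) => [a _|S _]; first by rewrite mxE eqxx.
by rewrite -mx11_scalar.
Qed.

End SymmetricDeterminantSums.

(** * Closed forms of the sums, relative to the order of GL *)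

Section SymmetricCounts.
Variables (F : finFieldType) (K : numFieldType).
Let q : K := #|F|%:R.

(** Counted as a set of matrices so that m = 0 is covered, with value 1. *)
Definition gl_order m : nat := #|[set g : 'M[F]_m | g \in unitmx]|.

Let q_gt1 : 1 < q. Proof. by rewrite ltr1n card_finNzRing_gt1. Qed.

Let q_neq0 : q != 0. Proof. by rewrite gt_eqF // (lt_trans ltr01 q_gt1). Qed.

Let qX_sub1_neq0 n : q ^+ n.+1 - 1 != 0.
Proof. by rewrite subr_eq0 gt_eqF // exprn_egt1. Qed.

Lemma gl_order0 : gl_order 0 = 1%N.
Proof.
rewrite /gl_order -(cards1 (1%:M : 'M[F]_0)); congr #|pred_of_set _|.
apply/setP => g; have -> : g = 1%:M by rewrite [g]flatmx0 [1%:M]flatmx0.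
by rewrite !inE unitmx1 eqxx.
Qed.

Lemma gl_orderS m : (gl_order m.+1)%:R = q ^+ m * (q ^+ m.+1 - 1) * (gl_order m)%:R.
Proof.
have glE n : (0 < n)%N ->
    gl_order n = (#|F| ^ 'C(n, 2) * \prod_(1 <= i < n.+1) (#|F| ^ i - 1))%N.
  case: n => // n _; rewrite -card_GL // cardsT /= card_sub /gl_order.
  by apply: eq_card => g; rewrite !inE.
case: m => [|m].
  rewrite glE // gl_order0 big_nat1 bin_small // expn0 mul1n expn1 mul1r mulr1.
  by rewrite natrB ?expr1 // ltnW // card_finNzRing_gt1.
rewrite !glE // big_nat_recr //= binS bin1 addnC expnD !natrM natrB; last first.
  by rewrite expn_gt0 ltnW // card_finNzRing_gt1.
by rewrite !natrX -/q; ring.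
Qed.

Lemma gl_order_neq0 m : (gl_order m)%:R != 0 :> K.
Proof.
rewrite pnatr_eq0 -lt0n; apply/card_gt0P; exists 1%:M.
by rewrite inE unitmx1.
Qed.

(** The q-Pochhammer symbol (p; p)_k, used with p = q^-2. *)
Definition pochhammer (p : K) k : K := \prod_(i < k) (1 - p ^+ i.+1).

Lemma sym_sum_gl_rec f :
  (forall x y, f (x * y) = f x * f y) -> f 0 = 0 ->
  (forall x, x != 0 -> f (x ^+ 2) = 1) ->
  forall m, @sym_sum F K f m.+2 / (gl_order m.+2)%:R =
    ((\sum_a f a) * (sym_sum f m.+1 / (gl_order m.+1)%:R)
     + f (-1) * q ^- m * (sym_sum f m / (gl_order m)%:R)) / (q ^+ m.+2 - 1).
Proof.
move=> fM f0 fsq m; rewrite sym_sum_rec // !gl_orderS -/q.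
have := gl_order_neq0 m; have := qX_sub1_neq0 m; have := qX_sub1_neq0 m.+1.
have : q ^+ m != 0 by rewrite expf_neq0.
rewrite !exprS; set Q := q ^+ m; set G := (gl_order m)%:R => Q0 h1 h2 G0.
by field; rewrite G0 Q0 q_neq0 h1 h2.
Qed.

Lemma pochhammer_neq0 k : pochhammer (q ^- 2) k != 0.
Proof.
apply/prodf_neq0 => i _; rewrite subr_eq0 gt_eqF //.
rewrite exprn_ilt1 // ?invr_ge0 ?exprn_ge0 ?ler0n //.
by rewrite invf_lt1 ?exprn_egt1 ?exprn_gt0 // (lt_trans ltr01 q_gt1).
Qed.

Lemma pochhammerS p k : pochhammer p k.+1 = pochhammer p k * (1 - p ^+ k.+1).
Proof. by rewrite /pochhammer big_ord_recr. Qed.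

Lemma pochhammer0 p : pochhammer p 0 = 1.
Proof. by rewrite /pochhammer big_ord0. Qed.

(** The recurrence has order two, so both parities are carried through one induction. *)
Lemma sym_count_ratio k :
  sym_sum (@is_nonzero F K) (2 * k) / (gl_order (2 * k))%:R
    = q ^+ k / (q ^+ (2 * k ^ 2) * pochhammer (q ^- 2) k) /\
  sym_sum (@is_nonzero F K) (2 * k).+1 / (gl_order (2 * k).+1)%:R
    = (q ^+ k * q ^+ (2 * k ^ 2) * pochhammer (q ^- 2) k)^-1.
Proof.
have rec := sym_sum_gl_rec (@is_nonzeroM F K) (is_nonzero0 F K) (@is_nonzero_sqr F K).
have N1 : is_nonzero K (-1 : F) = 1 by rewrite /is_nonzero oppr_eq0 oner_neq0.
rewrite {}N1 sum_is_nonzero -/q in rec.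
elim: k => [|k [IHe IHo]].
  rewrite muln0 sym_sum0 ?sym_sum1 ?sum_is_nonzero; try exact: is_nonzero_sqr.
  rewrite gl_orderS gl_order0 pochhammer0 !expr0 !mulr1 expr1 !mul1r invr1.
  by split=> //; rewrite divff //; exact: (qX_sub1_neq0 0).
have e2 : q ^+ (2 * k) = q ^+ k ^+ 2 by rewrite mulnC exprM.
have e3 : q ^+ (2 * k).+2 = q ^+ k ^+ 2 * q ^+ 2 by rewrite -e2 -exprD addn2.
have e4 : (q ^- 2) ^+ k.+1 = (q ^+ k ^+ 2 * q ^+ 2)^-1.
  by rewrite -e3 exprVn -exprM mulnS.
have eS : q ^+ (2 * k.+1 ^ 2) = q ^+ (2 * k ^ 2) * q ^+ k ^+ 4 * q ^+ 2.
  by rewrite -exprM -!exprD; congr (q ^+ _); lia.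
have a0 : q ^+ k != 0 by rewrite expf_neq0.
have b0 : q ^+ (2 * k ^ 2) != 0 by rewrite expf_neq0.
have h1 := qX_sub1_neq0 (2 * k).+1; rewrite e3 in h1.
have c0 := pochhammer_neq0 k.
have ev : sym_sum (@is_nonzero F K) (2 * k.+1) / (gl_order (2 * k.+1))%:R
    = q ^+ k.+1 / (q ^+ (2 * k.+1 ^ 2) * pochhammer (q ^- 2) k.+1).
  rewrite mulnS rec IHe IHo eS pochhammerS e4 e3 e2 [q ^+ k.+1]exprS.
  move: (q ^+ k) (q ^+ (2 * k ^ 2)) (pochhammer _ k) a0 b0 c0 h1 => a b c a0 b0 c0 h1.
  by field; rewrite -/q exprMn a0 b0 c0 h1 q_neq0.
split=> //.
have h2 := qX_sub1_neq0 (2 * k).+2; rewrite exprS e3 in h2.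
rewrite mulnS in ev *; rewrite rec ev IHo eS pochhammerS e4.
rewrite [q ^+ k.+1]exprS [q ^+ (2 * k).+3]exprS e3 [q ^+ (2 * k).+1]exprS e2.
move: (q ^+ k) (q ^+ (2 * k ^ 2)) (pochhammer _ k) a0 b0 c0 h1 h2 => a b c a0 b0 c0 h1 h2.
by field; rewrite -/q ?exprMn a0 b0 c0 h1 q_neq0 h2.
Qed.

(** As [qchar] sums to 0, the recurrence only links m + 2 to m; each step brings a factor
    [qchar K (-1)]. *)
Lemma sym_qchar_ratio (delta : F) k : (forall x : F, x ^+ 2 != delta) ->
  sym_sum (@qchar F K) (2 * k) / (gl_order (2 * k))%:R
    = qchar K ((-1 : F) ^+ k) / (q ^+ (2 * k ^ 2) * pochhammer (q ^- 2) k).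
Proof.
move=> nd; have rec := sym_sum_gl_rec (@qcharM F K) (qchar0 F K) (@qchar_sqr F K).
rewrite (sum_qchar K nd) in rec.
elim: k => [|k IH].
  rewrite muln0 sym_sum0; last exact: qchar_sqr.
  by rewrite gl_order0 pochhammer0 !expr0 mulr1 weight1 //; exact: qchar_sqr.
have e3 : q ^+ (2 * k).+2 = q ^+ (2 * k) * q ^+ 2 by rewrite -exprD addn2.
have e4 : (q ^- 2) ^+ k.+1 = (q ^+ (2 * k) * q ^+ 2)^-1.
  by rewrite -e3 exprVn -exprM mulnS.
have eS : q ^+ (2 * k.+1 ^ 2) = q ^+ (2 * k ^ 2) * q ^+ (2 * k) ^+ 2 * q ^+ 2.
  by rewrite -exprM -!exprD; congr (q ^+ _); lia.
have a0 : q ^+ (2 * k) != 0 by rewrite expf_neq0.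
have b0 : q ^+ (2 * k ^ 2) != 0 by rewrite expf_neq0.
have h1 := qX_sub1_neq0 (2 * k).+1; rewrite e3 in h1.
have c0 := pochhammer_neq0 k.
rewrite mulnS rec IH mul0r add0r [(-1) ^+ k.+1]exprS qcharM eS pochhammerS e4 e3.
move: (q ^+ (2 * k)) (q ^+ (2 * k ^ 2)) (pochhammer _ k) a0 b0 c0 h1 => a b c a0 b0 c0 h1.
by field; rewrite -/q ?exprMn a0 b0 c0 h1 q_neq0.
Qed.

Lemma sym_qchar_odd (delta : F) k : (forall x : F, x ^+ 2 != delta) ->
  sym_sum (@qchar F K) (2 * k).+1 = 0.
Proof.
move=> nd; elim: k => [|k IH]; first by rewrite muln0 sym_sum1 (sum_qchar K nd).
rewrite mulnS sym_sum_rec ?IH ?mulr0 ?(sum_qchar K nd) ?mul0r ?addr0 //.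
- exact: qcharM.
- exact: qchar0.
- exact: qchar_sqr.
Qed.

End SymmetricCounts.

                                            

(** * Classification of nondegenerate symmetric forms up to congruence *)

Section Congruence.
Variable F : finFieldType.
Hypothesis odd_q : odd #|F|.

Definition congruent m (S T : 'M[F]_m) : Prop :=
  exists2 g, g \in unitmx & g *m S *m g^T = T.

Lemma congruent_trans m (S T U : 'M[F]_m) :
  congruent S T -> congruent T U -> congruent S U.
Proof.
move=> [g ug <-] [h uh <-]; exists (h *m g); first by rewrite unitmx_mul uh.
by rewrite trmx_mul !mulmxA.
Qed.

Lemma congruent_sym m (S T : 'M[F]_m) : congruent S T -> congruent T S.
Proof.
move=> [g ug <-]; exists (invmx g); first by rewrite unitmx_inv.
by rewrite trmx_inv !mulmxA mulVmx // mul1mx mulmxK // unitmx_tr.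
Qed.

Lemma congruent_det m (S T : 'M[F]_m) : congruent S T ->
  exists2 c, c != 0 & \det T = c ^+ 2 * \det S.
Proof.
move=> [g ug <-]; exists (\det g); first by rewrite unitmxE unitfE in ug.
by rewrite !det_mulmx det_tr; ring.
Qed.

Lemma congruent_trmx m (S T : 'M[F]_m) : congruent S T -> S^T = S -> T^T = T.
Proof. by move=> [g _ <-] sS; rewrite !trmx_mul trmxK sS mulmxA. Qed.

Lemma congruent_block m (A : 'M[F]_1) (S T : 'M[F]_m) : congruent S T ->
  congruent (block_mx A 0 0 S) (block_mx A 0 0 T).
Proof.
move=> [g ug <-]; exists (block_mx 1%:M 0 0 g).
  by rewrite unitmxE det_ublock det1 mul1r -unitmxE.
rewrite tr_block_mx !trmx0 trmx1 !mulmx_block.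
by rewrite !(mul0mx, mulmx0, mul1mx, mulmx1, addr0, add0r).
Qed.

(** Polarisation: if all values v S v^T vanish, so does twice the bilinear form, and 2 is
    invertible. *)
Lemma sym_anisotropic m (S : 'M[F]_m) : S^T = S -> S != 0 ->
  exists v : 'rV_m, v *m S *m v^T != 0.
Proof.
move=> sS S0; have [/existsP //|] := boolP [exists v : 'rV_m, v *m S *m v^T != 0].
rewrite negb_exists => /forallP iso; case/eqP: S0.
have tr11 (M : 'M[F]_1) : M^T = M by rewrite [M]mx11_scalar tr_scalar_mx.
have isoE (v : 'rV_m) : v *m S *m v^T = 0 by apply/eqP; rewrite -[_ == _]negbK.
have bil (v w : 'rV_m) : v *m S *m w^T = 0.
  have /eqP := isoE (v + w).
  rewrite linearD /= !mulmxDl !mulmxDr !isoE add0r addr0.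
  have -> : w *m S *m v^T = v *m S *m w^T.
    by rewrite -[RHS]tr11 !trmx_mul trmxK sS mulmxA.
  rewrite -mulr2n -scaler_nat scaler_eq0 (negPf (odd_card_two_neq0 odd_q)) /=.
  by move/eqP.
apply/matrixP => i j; have /matrixP/(_ 0 0) := bil (delta_mx 0 i) (delta_mx 0 j).
by rewrite -rowE trmx_delta -colE !mxE.
Qed.

(** Complete v to a basis and clear the rest of its row and column: v splits off orthogonally
    because its value a is invertible. *)
Lemma congruent_split m (S : 'M[F]_(1 + m)) (v : 'rV_(1 + m)) a : S^T = S ->
  v *m S *m v^T = a%:M -> a != 0 ->
  exists2 S1 : 'M_m, S1^T = S1 & congruent S (block_mx a%:M 0 0 S1).
Proof.
move=> sS va a0.
have v0 : v != 0.
  apply: contraNneq a0 => v0; move: va; rewrite v0 !mul0mx => /matrixP/(_ 0 0).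
  by rewrite !mxE eqxx mulr1n => <-.
pose e : 'rV[F]_(1 + m) := row_mx 1%:M 0.
have eK : e *m e^T = 1%:M by rewrite tr_row_mx mul_row_col trmx0 trmx1 mulmx1 mul0mx addr0.
have [g ug eg] : exists2 g : 'M[F]_(1 + m), g \in unitmx & e *m g = v.
  have [|g ug eg] := @complete_unitmx _ 1 (1 + m) e (e^T *m v).
    rewrite mulmxA eK mul1mx !rank_rV v0; suff -> : e != 0 by [].
    apply: contraTneq isT => e0; have := eK; rewrite e0 mul0mx => /matrixP/(_ 0 0)/eqP.
    by rewrite !mxE eqxx eq_sym oner_eq0.
  by exists g => //; rewrite -eg mulmxA eK mul1mx.
pose T := g *m S *m g^T.
have ST : congruent S T by exists g.
have sT := congruent_trmx ST sS.
have T00 : ulsubmx T = a%:M.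
  rewrite -va -eg trmx_mul !mulmxA.
  rewrite -[e *m g *m S *m g^T *m e^T]/(_) -!mulmxA (mulmxA g) (mulmxA _ g^T) -/T.
  rewrite -[T]submxK tr_row_mx trmx1 trmx0 mul_block_col !mulmx0 !addr0 !mulmx1.
  by rewrite mul_row_col mul1mx mul0mx addr0 block_mxKul.
pose b := ursubmx T.
(* The orthogonal complement of v carries the Schur complement of the corner a. *)
exists (drsubmx T - a^-1 *: (b^T *m b)).
  by rewrite linearB linearZ /= trmx_mul trmxK trmx_drsub sT.
apply: congruent_trans ST _; exists (block_mx 1%:M 0 (- a^-1 *: b^T) 1%:M).
  by rewrite unitmxE det_lblock !det1 mulr1 unitr1.
rewrite -{1}[T]submxK T00 -/b.
have -> : dlsubmx T = b^T by rewrite /b trmx_ursub sT.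
rewrite tr_block_mx !trmx0 !trmx1 linearZ /= trmxK !mulmx_block.
rewrite !(mul0mx, mulmx0, mul1mx, mulmx1, addr0, add0r) mul_mx_scalar mul_scalar_mx.
rewrite !scalerA mulrN divff // !scaleN1r !addNr mul0mx add0r.
by rewrite -scalemxAl scaleNr addrC.
Qed.

Lemma det_block_diag_scalar m a (S : 'M[F]_m) :
  \det (block_mx (a%:M : 'M_1) 0 0 S) = a * \det S.
Proof. by rewrite det_ublock det_scalar1. Qed.

(** In rank at least 2 there are two orthogonal vectors of nonzero values a and b, and a x^2 + b y^2
    = 1 is solvable. *)
Lemma sym_represents1 m (S : 'M[F]_m.+2) : S^T = S -> \det S != 0 ->
  exists v : 'rV_m.+2, v *m S *m v^T = 1%:M.
Proof.
move=> sS dS.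
have nz n (M : 'M[F]_n.+1) : \det M != 0 -> M != 0.
  by apply: contraNneq => ->; rewrite det0.
have [v] := sym_anisotropic sS (nz _ _ dS).
rewrite [v *m S *m v^T]mx11_scalar; set a := (_ 0 0) => va0.
have a0 : a != 0 by apply: contraNneq va0 => ->; rewrite raddf0.
have [S1 sS1 SS1] := @congruent_split m.+1 S v a sS (mx11_scalar _) a0.
have dS1 : \det S1 != 0.
  have [c c0] := congruent_det SS1; rewrite (@det_block_diag_scalar m.+1) => e.
  have : a * \det S1 != 0 by rewrite e mulf_neq0 // expf_neq0.
  by rewrite mulf_eq0 negb_or => /andP[].
have [w] := sym_anisotropic sS1 (nz _ _ dS1).
rewrite [w *m S1 *m w^T]mx11_scalar; set b := (_ 0 0) => wb0.
have b0 : b != 0 by apply: contraNneq wb0 => ->; rewrite raddf0.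
have [x [y xy]] := two_squares_repr1 a0 b0.
have [g ug gS] := SS1.
pose z : 'rV[F]_(1 + m.+1) := row_mx x%:M (y *: w).
exists (z *m g).
have -> : z *m g *m S *m (z *m g)^T = z *m (g *m S *m g^T) *m z^T.
  by rewrite trmx_mul !mulmxA.
rewrite gS tr_row_mx tr_scalar_mx linearZ /= mul_row_block !mulmx0 addr0 add0r.
rewrite mul_row_col -scalemxAl -scalemxAl -scalemxAr scalerA [w *m S1 *m w^T]mx11_scalar.
by rewrite -/b -!scalar_mxM scale_scalar_mx -raddfD /= -xy; congr (_%:M); ring.
Qed.

(** From dimension 2 on, both forms split off the value 1, which reduces the dimension and keeps the
    determinants up to squares. *)
Lemma congruent_classification m (S T : 'M[F]_m) : S^T = S -> T^T = T ->
  \det S != 0 -> \det T != 0 -> square (\det S * \det T) -> congruent S T.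
Proof.
case: m S T => [|m] S T.
  by move=> *; exists 1%:M; rewrite ?unitmx1 // [LHS]flatmx0 [RHS]flatmx0.
elim: m S T => [|m IH] S T sS sT dS dT.
  rewrite [S]mx11_scalar [T]mx11_scalar !det_scalar1 in dS dT *.
  move=> /squareP [y e].
  have y0 : y != 0.
    have : S 0 0 * T 0 0 != 0 by rewrite mulf_neq0.
    by apply: contraNneq => y0; rewrite e y0 expr0n.
  (* As y^2 is the product of the two entries, (y / S)^2 S = T. *)
  exists (y / S 0 0)%:M.
    by rewrite unitmxE det_scalar1 unitfE mulf_neq0 // invr_eq0.
  rewrite tr_scalar_mx -!scalar_mxM; congr (_%:M).
  apply: (mulfI dS); rewrite e; by field.
move=> /squareP [y e].
have split1 (U : 'M[F]_m.+2) : U^T = U -> \det U != 0 ->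
    exists U1 : 'M_m.+1, [/\ U1^T = U1, congruent U (block_mx 1%:M 0 0 U1 : 'M_(1 + m.+1)) &
      exists2 c, c != 0 & \det U1 = c ^+ 2 * \det U].
  move=> sU dU; have [v v1] := sym_represents1 sU dU.
  have [U1 sU1 UU1] := @congruent_split m.+1 U v 1 sU v1 (oner_neq0 _).
  exists U1; split=> //; have [c c0] := congruent_det UU1.
  by rewrite (@det_block_diag_scalar m.+1) mul1r; exists c.
have [S1 [sS1 SS1 [c c0 dS1]]] := split1 S sS dS.
have [T1 [sT1 TT1 [d d0 dT1]]] := split1 T sT dT.
apply: congruent_trans SS1 _; apply: congruent_trans (congruent_sym TT1).
apply: (@congruent_block m.+1); apply: IH => //.
- by rewrite dS1 mulf_neq0 // expf_neq0.
- by rewrite dT1 mulf_neq0 // expf_neq0.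
apply/squareP; exists (c * d * y); rewrite dS1 dT1 exprMn -e; ring.
Qed.

End Congruence.

                                                

Lemma card_fibers (aT rT : finType) (A : {set aT}) (B : {set rT}) (f : aT -> rT) n :
  (forall x, x \in A -> f x \in B) ->
  (forall y, y \in B -> #|[set x in A | f x == y]| = n) -> #|A| = (#|B| * n)%N.
Proof.
move=> fAB fib; rewrite -sum1_card (partition_big f (mem B)) //=.
rewrite -sum_nat_const; apply: eq_bigr => y yB; rewrite -(fib y yB) -sum1_card.
by apply: eq_bigl => x; rewrite inE.
Qed.

(** * Double counting of involutions and invariant forms *)

Section InvolutionCounts.
Variables (F : finFieldType) (K : numFieldType).
Hypothesis odd_q : odd #|F|.

Definition gl_set m : {set 'M[F]_m} := [set g | g \in unitmx].

Definition form_stab m (S : 'M[F]_m) : {set 'M[F]_m} :=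
  [set g in gl_set m | g *m S *m g^T == S].

Definition sym_class m (s : F) : {set 'M[F]_m} :=
  [set T | [&& T^T == T, \det T != 0 & square (s * \det T)]].

(** Orbit-stabiliser for the action of GL by congruence: by the classification, [sym_class] is the
    whole orbit of S. *)
Lemma card_stab_class m (S : 'M[F]_m) : S^T = S -> \det S != 0 ->
  (#|sym_class m (\det S)| * #|form_stab S|)%N = gl_order F m.
Proof.
move=> sS dS; rewrite /gl_order; symmetry.
apply: (card_fibers (f := fun g => g *m S *m g^T)) => [g|T].
  rewrite !inE => ug; rewrite !trmx_mul trmxK sS mulmxA eqxx /=.
  have dg : \det g != 0 by rewrite unitmxE unitfE in ug.
  rewrite !det_mulmx det_tr !mulf_neq0 //=.
  by apply/squareP; exists (\det g * \det S); ring.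
rewrite inE => /and3P [/eqP sT dT sq].
have [h uh hT] := congruent_classification odd_q sS sT dS dT sq.
(* The fibre over T = h S h^T is the coset of the stabiliser by h. *)
rewrite -[RHS](card_imset _ (can_inj (mulKmx uh))); apply: eq_card => g.
rewrite !inE; apply/andP/imsetP => [[ug /eqP gT]|[k]].
  exists (invmx h *m g); last by rewrite mulKVmx.
  rewrite !inE unitmx_mul unitmx_inv uh ug /=.
  rewrite trmx_mul !mulmxA -[_ *m g *m S]mulmxA -[_ *m (g *m S) *m _]mulmxA gT -hT.
  by rewrite trmx_inv !mulmxA mulVmx // mul1mx mulmxK // unitmx_tr.
rewrite !inE => /andP[uk /eqP kS] ->; split; first by rewrite unitmx_mul uh.
by rewrite trmx_mul !mulmxA -[h *m k *m S]mulmxA -[h *m _ *m k^T]mulmxA kS hT.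
Qed.

Definition inv_block j l : 'M[F]_(j + l) := block_mx (- 1%:M) 0 0 1%:M.

(** The rank of g - 1 is the dimension j of the (-1)-eigenspace. *)
Definition involutions m j : {set 'M[F]_m} :=
  [set g | (g *m g == 1%:M) && (\rank (g - 1%:M) == j)].

Lemma inv_block_involution j l : inv_block j l *m inv_block j l = 1%:M.
Proof.
rewrite mulmx_block !(mul0mx, mulmx0, mulmx1, addr0, add0r) mulNmx mulmxN opprK.
by rewrite mulmx1 -scalar_mx_block.
Qed.

Lemma inv_block_rank j l : \rank (inv_block j l - 1%:M) = j.
Proof.
have two0 := odd_card_two_neq0 odd_q.
rewrite (scalar_mx_block j l 1) opp_block_mx add_block_mx !oppr0 !addr0 subrr.
rewrite -opprD -mulr2n -scaler_nat -scaleNr.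
rewrite rank_diag_block_mx mxrank0 addn0 mxrank_scale_nz ?mxrank1 //.
by rewrite oppr_eq0.
Qed.

(** The row spaces of g - 1 and g + 1 consist of eigenvectors for -1 and 1. They are complementary
    because 2 is invertible, and stacking their bases gives the conjugating matrix. *)
Lemma involution_conj j l (g : 'M[F]_(j + l)) : g \in involutions (j + l) j ->
  exists2 h, h \in unitmx & g = h *m inv_block j l *m invmx h.
Proof.
have two0 := odd_card_two_neq0 odd_q.
rewrite inE => /andP[/eqP gg /eqP rk].
have gm : (g - 1%:M) *m g = - (g - 1%:M).
  by rewrite mulmxBl gg mul1mx opprB.
have gp : (g + 1%:M) *m g = g + 1%:M.
  by rewrite mulmxDl gg mul1mx addrC.
pose gp1 : 'M[F]_(j + l) := g + 1%:M.
have sum1 : ((g - 1%:M) + gp1 :=: 1%:M)%MS.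
  apply/eqmxP; rewrite submx1 /=.
  have one_halves : 1%:M = 2^-1 *: (gp1 - (g - 1%:M)) :> 'M[F]_(j + l).
    by rewrite /gp1 opprB addrC addrA subrK -mulr2n -scaler_nat scalerA mulVf ?scale1r.
  rewrite [X in (X <= _)%MS]one_halves; apply/scalemx_sub/addmx_sub; first exact: addsmxSr.
  by rewrite eqmx_opp addsmxSl.
have cap0 : ((g - 1%:M) :&: gp1)%MS = 0.
  apply/eqP; rewrite -submx0; apply/rV_subP => u.
  rewrite sub_capmx => /andP[/submxP [a ua] /submxP [b ub]].
  have um : u *m g = - u by rewrite ua -mulmxA gm mulmxN.
  have up : u *m g = u by rewrite ub -mulmxA gp.
  rewrite submx0; have /eqP : u + u = 0 by rewrite -{2}up um subrr.
  by rewrite -mulr2n -scaler_nat scaler_eq0 (negPf two0).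
have rkp : \rank gp1 = l.
  have := mxrank_sum_cap (g - 1%:M) gp1.
  by rewrite cap0 mxrank0 addn0 sum1 mxrank1 rk => /addnI.
have base n r (M : 'M[F]_n) : \rank M = r -> exists A : 'M[F]_(r, n), (A :=: M)%MS.
  by move=> <-; exists (row_base M); exact: eq_row_base.
have [A eA] := base _ _ _ rk; have [B eB] := base _ _ _ rkp.
pose h := col_mx A B.
have uh : h \in unitmx.
  rewrite -row_full_unit -sub1mx -addsmxE.
  by rewrite (adds_eqmx eA eB) sum1.
exists (invmx h); first by rewrite unitmx_inv.
rewrite invmxK -mulmxA; apply: (canRL (mulKmx uh)).
have Ag : A *m g = - A.
  have /submxP [a ->] : (A <= g - 1%:M)%MS by rewrite eA.
  by rewrite -mulmxA gm mulmxN.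
have Bg : B *m g = B.
  have /submxP [b ->] : (B <= gp1)%MS by rewrite eB.
  by rewrite -mulmxA gp.
by rewrite /h mul_col_mx Ag Bg mul_block_col !mul0mx addr0 add0r mulNmx !mul1mx.
Qed.

Lemma involution_conj_mem j l (h : 'M[F]_(j + l)) : h \in unitmx ->
  h *m inv_block j l *m invmx h \in involutions (j + l) j.
Proof.
move=> uh; rewrite inE; apply/andP; split; apply/eqP.
  rewrite !mulmxA mulmxKV // -[_ *m inv_block j l *m inv_block j l]mulmxA.
  by rewrite inv_block_involution mulmx1 mulmxV.
have -> : h *m inv_block j l *m invmx h - 1%:M = h *m (inv_block j l - 1%:M) *m invmx h.
  by rewrite mulmxBr mulmxBl mulmx1 mulmxV.
rewrite mxrankMfree ?row_free_unit ?unitmx_inv //.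
by rewrite (eqmxMfull _ _) ?row_full_unit // inv_block_rank.
Qed.

Lemma involution_det j l (g : 'M[F]_(j + l)) : g \in involutions (j + l) j ->
  \det g = (-1) ^+ j.
Proof.
move=> /involution_conj [h uh ->]; rewrite !det_mulmx det_inv mulrAC.
rewrite divff ?mul1r; last by rewrite unitmxE unitfE in uh.
by rewrite det_ublock det1 mulr1 -scaleN1r detZ det1 mulr1.
Qed.

Lemma comm_inv_block j l (k : 'M[F]_(j + l)) :
  k *m inv_block j l = inv_block j l *m k ->
  k = block_mx (ulsubmx k) 0 0 (drsubmx k).
Proof.
have two0 := odd_card_two_neq0 odd_q.
have eqN m n (A : 'M[F]_(m, n)) : A = - A -> A = 0.
  move/eqP; rewrite -addr_eq0 -mulr2n -scaler_nat scaler_eq0 (negPf two0).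
  by move/eqP.
move=> e; rewrite -[LHS]submxK; move: e; rewrite -{1 2}[k]submxK !mulmx_block.
rewrite !(mul0mx, mulmx0, mulmx1, mul1mx, addr0, add0r, mulmxN, mulNmx).
by case/eq_block_mx => _ /eqN -> /esym/eqN -> _.
Qed.

Lemma block_diag_unit j l (a : 'M[F]_j) (b : 'M[F]_l) :
  (block_mx a 0 0 b \in unitmx) = (a \in unitmx) && (b \in unitmx).
Proof. by rewrite !unitmxE det_ublock unitrM. Qed.

(** A conjugacy class has the index of its centraliser as size; the centraliser of diag(-1_j, 1_l)
    is GL_j x GL_l. *)
Lemma card_involutions j l :
  (#|involutions (j + l) j| * (gl_order F j * gl_order F l))%N = gl_order F (j + l).
Proof.
symmetry; rewrite {3}/gl_order.
apply: (card_fibers (f := fun h => h *m inv_block j l *m invmx h)) => [h|g].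
  by rewrite inE => /involution_conj_mem.
move=> /involution_conj [h0 uh0 ->].
rewrite -cardsX -[RHS](card_imset (f := fun c => h0 *m block_mx c.1 0 0 c.2)); last first.
  move=> [a b] [c d] /(can_inj (mulKmx uh0)) /=.
  by case/eq_block_mx => -> _ _ ->.
apply: eq_card => h; rewrite !inE; apply/andP/imsetP => [[uh /eqP e]|[[a b]]].
  pose k := invmx h0 *m h.
  have kE : k = block_mx (ulsubmx k) 0 0 (drsubmx k).
    apply: comm_inv_block; apply: (can_inj (mulKmx uh0)).
    by rewrite /k !mulmxA mulmxV // mul1mx -e mulmxKV.
  exists (ulsubmx k, drsubmx k); last by rewrite /= -kE /k mulKVmx.
  by rewrite !inE /= -block_diag_unit -kE unitmx_mul unitmx_inv uh0.
rewrite !inE /= => uab ->; set k := block_mx _ _ _ _.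
have uk : k \in unitmx by rewrite block_diag_unit.
have uhk : h0 *m k \in unitmx by rewrite unitmx_mul uh0.
split=> //.
have kJ : k *m inv_block j l = inv_block j l *m k.
  by rewrite !mulmx_block !(mul0mx, mulmx0, mulmx1, mul1mx, addr0, add0r, mulmxN, mulNmx).
apply/eqP; apply: (can_inj (mulmxK uhk)).
by rewrite mulmxKV // -!mulmxA mulKmx // kJ.
Qed.

Definition form_pairs j l (s : F) : {set 'M[F]_j * 'M[F]_l} :=
  [set T | [&& T.1^T == T.1, T.2^T == T.2, \det T.1 * \det T.2 != 0
             & square (s * (\det T.1 * \det T.2))]].

(** In a basis where g is diag(-1_j, 1_l), a form is invariant exactly when the two eigenspaces are
    orthogonal. The change of basis alters the determinant by a square. *)
Lemma card_invariant_forms j l (s : F) g : g \in involutions (j + l) j ->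
  #|[set S in sym_class (j + l) s | g *m S *m g^T == S]| = #|form_pairs j l s|.
Proof.
move=> /involution_conj [h uh gE].
have uhT : h^T \in unitmx by rewrite unitmx_tr.
have dh : \det h != 0 by rewrite unitmxE unitfE in uh.
pose J := inv_block j l.
have JT : J^T = J by rewrite /J /inv_block tr_block_mx !trmx0 linearN /= !trmx1.
have hI : injective (fun A : 'M[F]_(j + l) => h *m A *m h^T).
  by move=> A B /(can_inj (mulmxK uhT))/(can_inj (mulKmx uh)).
have sqE c : square (s * ((\det h * c) * \det h)) = square (s * c).
  have -> : s * ((\det h * c) * \det h) = \det h ^+ 2 * (s * c) by ring.
  rewrite (@squareM _ (\det h ^+ 2)) ?expf_neq0 //.
  by apply/squareP; exists (\det h).
rewrite -[RHS](card_imset (f := fun T => h *m block_mx T.1 0 0 T.2 *m h^T)); last first.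
  by move=> [a b] [c d] /hI /= /eq_block_mx[-> _ _ ->].
have fixE A : g *m (h *m A *m h^T) *m g^T = h *m (J *m A *m J) *m h^T.
  rewrite gE !trmx_mul JT trmx_inv -/J -!mulmxA.
  by rewrite (mulKmx uh) (mulKVmx uhT).
apply: eq_card => S; rewrite !inE; apply/idP/imsetP => [|[[a b]]].
  have [A ->] : exists A, S = h *m A *m h^T.
    by exists (invmx h *m S *m invmx h^T); rewrite !mulmxA mulmxV // mul1mx mulmxKV.
  rewrite fixE => /andP[/and3P[/eqP sA dA sqA] /eqP /hI JA].
  have AE : A = block_mx (ulsubmx A) 0 0 (drsubmx A).
    apply: comm_inv_block; rewrite -/J -[in LHS]JA -[LHS]mulmxA.
    by rewrite inv_block_involution mulmx1.
  exists (ulsubmx A, drsubmx A) => /=; last by rewrite -AE.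
  move: sA; rewrite !trmx_mul trmxK mulmxA => /hI sA.
  rewrite !inE /= trmx_ulsub trmx_drsub sA !eqxx -(det_ublock _ 0) -AE /=.
  move: dA sqA.
  by rewrite !det_mulmx det_tr sqE !mulf_eq0 !negb_or => /andP[/andP[_ ->]] _ ->.
rewrite !inE /= => /and4P[/eqP sa /eqP sb d sq] ->.
rewrite !trmx_mul trmxK tr_block_mx !trmx0 sa sb mulmxA eqxx /=.
rewrite !det_mulmx det_tr det_ublock sqE sq !mulf_neq0 //= ?andbT; last first.
- by move: d; rewrite mulf_eq0 negb_or => /andP[].
- by move: d; rewrite mulf_eq0 negb_or => /andP[].
rewrite fixE; apply/eqP; congr (_ *m _ *m _).
rewrite !mulmx_block !(mul0mx, mulmx0, mulmx1, mul1mx, addr0, add0r, mulmxN, mulNmx).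
by rewrite !oppr0 opprK.
Qed.

(** For d nonzero, (1 + chi(s) chi(d)) / 2 is the indicator that sd is a square; multiplicativity in
    d = det A det B factors each part into two sums. *)
Lemma card_form_pairs j l (s : F) : s != 0 -> (#|form_pairs j l s|)%:R =
  (sym_sum (@is_nonzero F K) j * sym_sum (@is_nonzero F K) l
   + qchar K s * (sym_sum (@qchar F K) j * sym_sum (@qchar F K) l)) / 2.
Proof.
move=> s0; rewrite -sum1_card natr_sum /sym_sum.
rewrite [X in X + _]mulr_suml [X in _ + _ * X]mulr_suml mulr_sumr -big_split /= mulr_suml.
under [RHS]eq_bigr => A _.
  rewrite !mulr_sumr -big_split mulr_suml /=.
  over.
rewrite pair_big /= big_mkcond [RHS]big_mkcond /=; apply: eq_bigr => -[A B] _ /=.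
rewrite inE /=; case: eqP => //= _; case: eqP => //= _.
rewrite -is_nonzeroM -!qcharM /is_nonzero; set d := \det A * \det B.
have [->|d0] := eqVneq d 0; first by rewrite mulr0 qchar0 addr0 mul0r.
rewrite /qchar mulf_eq0 (negPf s0) (negPf d0) /=.
case: (square _); last by rewrite subrr mul0r.
by rewrite -mulr2n -[1 *+ 2]/2 divff // pnatr_eq0.
Qed.

Lemma form_stab_unit_involution m (S g : 'M[F]_m) : g *m g = 1%:M ->
  (g \in form_stab S) = (g *m S *m g^T == S).
Proof. by move=> gg; rewrite !inE; have [-> _] := mulmx1_unit gg. Qed.

Definition special_involutions m (S : 'M[F]_m) : {set 'M[F]_m} :=
  [set g in form_stab S | (\det g == 1) && (g *m g == 1%:M)].

Lemma involution_det_gen m j (g : 'M[F]_m) : g \in involutions m j ->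
  \det g = (-1) ^+ j.
Proof.
move=> gi; have jm : (j <= m)%N.
  by move: gi; rewrite inE => /andP[_ /eqP <-]; exact: rank_leq_row.
move: g gi; rewrite -(subnKC jm) => g; exact: involution_det.
Qed.

Lemma neqN1 : (-1 == 1 :> F) = false.
Proof.
apply/negbTE; have := odd_card_two_neq0 odd_q; apply: contra.
by rewrite eq_sym -addr_eq0.
Qed.

Lemma card_special_involutions_congruent m (S T : 'M[F]_m) : congruent S T ->
  #|special_involutions T| = #|special_involutions S|.
Proof.
move=> [h uh hS]; have uhT : h^T \in unitmx by rewrite unitmx_tr.
have uhV : invmx h \in unitmx by rewrite unitmx_inv.
have conj_inj : injective (fun g : 'M[F]_m => h *m g *m invmx h).
  by move=> g k /(can_inj (mulmxK uhV))/(can_inj (mulKmx uh)).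
have inE_conj g : (h *m g *m invmx h \in special_involutions T) = (g \in special_involutions S).
  have ggE : ((h *m g *m invmx h) *m (h *m g *m invmx h) == 1%:M) = (g *m g == 1%:M).
    rewrite -[RHS](inj_eq conj_inj) mulmx1 mulmxV //.
    by rewrite -!mulmxA (mulKmx uh).
  rewrite ![_ \in special_involutions _]inE ggE.
  have [gg|] := eqVneq (g *m g) 1%:M; last by rewrite !andbF.
  rewrite !form_stab_unit_involution //; last by apply/eqP; rewrite ggE gg.
  have -> : \det (h *m g *m invmx h) = \det g.
    rewrite !det_mulmx det_inv mulrAC divff ?mul1r //.
    by rewrite unitmxE unitfE in uh.
  congr (_ && _); rewrite -hS.
  have -> : h *m g *m invmx h *m (h *m S *m h^T) *m (h *m g *m invmx h)^T
      = h *m (g *m S *m g^T) *m h^T.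
    by rewrite !trmx_mul trmx_inv -!mulmxA (mulKmx uh) (mulKVmx uhT).
  by rewrite (can_eq (mulmxK uhT)) (can_eq (mulKmx uh)).
rewrite -[RHS](card_imset _ conj_inj); apply: eq_card => g.
apply/idP/imsetP => [gT|[k kS ->]]; last by rewrite inE_conj.
exists (invmx h *m g *m h); first by rewrite -inE_conj !mulmxA mulmxV // mul1mx mulmxK.
by rewrite !mulmxA mulmxV // mul1mx mulmxK.
Qed.

(** Both sides count pairs (T, g), T in the class of S and g an involution preserving T. Congruent
    forms have equally many such g, and det g = (-1)^j is 1 exactly for j even. *)
Lemma sum_special_involutions m (S : 'M[F]_m) : S^T = S -> \det S != 0 ->
  (#|sym_class m (\det S)| * #|special_involutions S| =
   \sum_(j < m.+1 | ~~ odd j) \sum_(g in involutions m j)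
      #|[set T in sym_class m (\det S) | g *m T *m g^T == T]|)%N.
Proof.
move=> sS dS.
have -> : (#|sym_class m (\det S)| * #|special_involutions S| =
    \sum_(T in sym_class m (\det S)) #|special_involutions T|)%N.
  rewrite -sum_nat_const; apply: eq_bigr => T; rewrite inE => /and3P[/eqP sT dT sq].
  apply/esym/card_special_involutions_congruent.
  exact: (congruent_classification odd_q).
have rk (g : 'M[F]_m) : (\rank (g - 1%:M)%R < m.+1)%N by rewrite ltnS rank_leq_row.
under [RHS]eq_bigr => j _ do under eq_bigr => g _ do rewrite -sum1_card.
rewrite (eq_bigr (fun T => \sum_(g : 'M[F]_m | (g *m g == 1%:M) &&
    ~~ odd (Ordinal (rk g)) && (g *m T *m g^T == T)) 1)%N); last first.
  move=> T _; rewrite -sum1_card; apply: eq_bigl => g; rewrite inE.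
  have [gg|] := eqVneq (g *m g) 1%:M; last by rewrite !andbF.
  rewrite form_stab_unit_involution // andbT andbC /=; congr (_ && _).
  rewrite (involution_det_gen (_ : g \in involutions m (\rank (g - 1%:M)))) //.
    by rewrite -signr_odd; case: (odd _); rewrite ?eqxx // expr1 neqN1.
  by rewrite inE gg !eqxx.
(* On both sides the sum over g is made the outer one; on the right g determines its index j. *)
pose good (g : 'M[F]_m) := (g *m g == 1%:M) && ~~ odd (Ordinal (rk g)).
rewrite (exchange_big_dep good) /=; last first.
  by move=> T g _ /andP[].
rewrite [RHS](exchange_big_dep good) /=.
  apply: eq_bigr => g /andP[gg od]; rewrite (big_pred1 (Ordinal (rk g))) /=.
    by apply: eq_bigl => T; rewrite !inE gg od.
  move=> j; rewrite inE gg /=; apply/andP/eqP => [[_ /eqP e]|->]; first exact/val_inj.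
  by rewrite /= od eqxx.
by move=> j g oj; rewrite inE /good => /andP[-> /eqP e] /=; rewrite e.
Qed.

                                                                                
                                                                                
                                                            
(** Dividing the double count by |GL_m| leaves, for each even j, the number of form pairs over
    |GL_j| |GL_{m-j}|. *)
Lemma special_involutions_ratio m (S : 'M[F]_m) : S^T = S -> \det S != 0 ->
  #|special_involutions S|%:R / #|form_stab S|%:R =
  \sum_(j < m.+1 | ~~ odd j)
    (sym_sum (@is_nonzero F K) j / (gl_order F j)%:R
     * (sym_sum (@is_nonzero F K) (m - j) / (gl_order F (m - j))%:R)
     + qchar K (\det S) * (sym_sum (@qchar F K) j / (gl_order F j)%:R
     * (sym_sum (@qchar F K) (m - j) / (gl_order F (m - j))%:R))) / 2.
Proof.
move=> sS dS.
have Gm := card_stab_class sS dS.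
have Gm0 := gl_order_neq0 F K m.
have /andP[c0 s0] : (#|sym_class m (\det S)|%:R != 0 :> K) && (#|form_stab S|%:R != 0 :> K).
  by move: Gm0; rewrite -Gm natrM mulf_eq0 negb_or.
transitivity ((#|sym_class m (\det S)| * #|special_involutions S|)%:R / (gl_order F m)%:R : K).
  rewrite -Gm !natrM; move: c0 s0; set a := _%:R; set b := _%:R => a0 b0.
  by field; rewrite a0 b0.
rewrite sum_special_involutions // natr_sum mulr_suml; apply: eq_bigr => j _.
have jm : (j <= m)%N by rewrite -ltnS.
have := card_involutions j (m - j).
have inv_forms := @card_invariant_forms j (m - j) (\det S).
rewrite subnKC // in inv_forms * => Gj.
rewrite (eq_bigr (fun=> #|form_pairs j (m - j) (\det S)|)); last first.
  by move=> g /inv_forms.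
rewrite sum_nat_const natrM card_form_pairs // -Gj !natrM.
have := gl_order_neq0 F K j; have := gl_order_neq0 F K (m - j).
have : #|involutions m j|%:R != 0 :> K.
  by move: Gm0; rewrite -Gj natrM mulf_eq0 negb_or => /andP[].
move: (gl_order F j)%:R (gl_order F (m - j))%:R #|involutions m j|%:R => a b c c0' b0 a0.
by field; rewrite a0 b0 c0'.
Qed.

End InvolutionCounts.

From mathcomp Require Import all_classical all_reals all_analysis.
From mathcomp Require Import complex.
Import numFieldNormedType.Exports.
Local Open Scope classical_set_scope.
Local Open Scope ring_scope.

                              

(** * Convergence of geometrically dominated complex series *)

Section ComplexSeries.
Variable R : realType.
Local Notation C := (Num.NumField.sort (R[i] : numFieldType)).
Local Open Scope complex_scope.

Lemma ge0_complex (e : R[i]) : 0 <= e -> exists2 r : R, 0 <= r & e = r%:C.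
Proof.
move=> e0; have eE : e = (complex.Re e)%:C by rewrite RRe_real // ger0_real.
by exists (complex.Re e) => //; rewrite -(lecR 0) -eE.
Qed.

Lemma cvg_real_complex (x : nat -> R) (a : R) :
  x @ \oo --> a -> (fun n => (x n)%:C : C) @ \oo --> (a%:C : C).
Proof.
move=> xa; apply/cvgrPdist_lt => e e0.
have [r _ er] := ge0_complex (ltW e0); rewrite er ltcR in e0.
move/cvgrPdist_lt: xa => /(_ _ e0); apply: filterS => n.
by rewrite er -rmorphB /= normc_def /= expr0n /= addr0 sqrtr_sqr ltcR.
Qed.

Lemma cvg_series_dominated (a : nat -> C) (M r : C) :
  0 <= r < 1 -> (forall n, `|a n| <= M * r ^+ n) -> cvgn (series a).
Proof.
move=> /andP[r0 r1] aM.
have M0 : 0 <= M by have := aM 0; rewrite expr0 mulr1; apply: le_trans.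
have [r' r'0 rR] := ge0_complex r0; have [M' M'0 MR] := ge0_complex M0.
have r'1 : r' < 1 by rewrite -(ltcR _ 1) -rR.
have key (b : nat -> R[i]) : (forall n, `|b n| <= M * r ^+ n) ->
    cvgn (series (fun n => complex.Re (b n))).
  move=> bM; apply: normed_cvg; apply: (@series_le_cvg _ _ (geometric M' r')).
  - by move=> n /=; exact: normr_ge0.
  - by move=> n; rewrite mulr_ge0 ?exprn_ge0.
  - move=> n; rewrite /= -lecR rmorphM rmorphXn /= -rR -MR.
    exact: le_trans (normc_ge_Re _) (bM n).
  - by apply: is_cvg_geometric_series; rewrite ger0_norm.
have cRe := key a aM.
have cIm : cvgn (series (fun n => complex.Im (a n))).
  (* Imaginary parts reduce to real parts of a sequence with the same moduli. *)
  suff -> : (fun n => complex.Im (a n)) = (fun n => complex.Re (- (a n * 'i))).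
    apply: key => n; rewrite normrN normrM [`|'i|](_ : _ = 1) ?mulr1 //.
    by rewrite normc_def /= expr0n expr1n add0r sqrtr1.
  by apply/funext => n; rewrite raddfN /= ReiNIm opprK.
have -> : series a = (fun n => (series (fun n => complex.Re (a n)) n)%:C
     + 'i * (series (fun n => complex.Im (a n)) n)%:C).
  apply/funext => n; rewrite /series /= !rmorph_sum mulr_sumr -big_split /=.
  by apply: eq_bigr => i _; exact: complexE.
apply: is_cvgD; first exact: (cvgP _ (cvg_real_complex cRe)).
apply: is_cvgM; first exact: is_cvg_cst.
exact: (cvgP _ (cvg_real_complex cIm)).
Qed.

End ComplexSeries.

(** * The two-variable theta series: bounds, functional equation, product *)

Section ThetaSeries.
Variable K : numFieldType.

Lemma lim_dist_le (x : nat -> K) (l c M : K) : x @ \oo --> l -> 0 < M ->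
  (forall n, `|x n - c| <= M) -> `|l - c| <= 2 * M.
Proof.
move=> xl M0 xM; move/cvgrPdist_lt: xl => /(_ _ M0) [N _ /(_ N (leqnn N))] /= lN.
rewrite -[l](subrK (x N)) -addrA mulr_natl.
by apply: le_trans (ler_normD _ _) _; rewrite lerD // ltW.
Qed.

Lemma cvg_qprod_shift (x z l : K) :
  (fun N => \prod_(i < N) (1 + z * x * x ^+ i)) @ \oo --> l ->
  (fun N => \prod_(i < N) (1 + z * x ^+ i)) @ \oo --> (1 + z) * l.
Proof.
move=> cl; rewrite -cvg_shiftS.
rewrite (_ : [sequence _]_n = (fun N => (1 + z) * \prod_(i < N) (1 + z * x * x ^+ i))).
  exact: cvgMl_tmp.
apply/funext => N; rewrite /= big_ord_recl expr0 mulr1; congr (_ * _).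
by apply: eq_bigr => i _; rewrite /= /bump /= add1n exprS mulrA.
Qed.

Variable q : K.
Hypothesis q3 : 3 <= q.
Let p := q ^- 2.

Let q_gt0 : 0 < q. Proof. exact: lt_le_trans q3. Qed.
Let q_neq0 : q != 0. Proof. by rewrite gt_eqF. Qed.
Let q_gt1 : 1 < q. Proof. by apply: lt_le_trans q3; rewrite ltr1n. Qed.
Let p_gt0 : 0 < p. Proof. by rewrite invr_gt0 exprn_gt0. Qed.
Let p3 : 3 * p <= 1.
Proof.
rewrite ler_pdivrMr ?exprn_gt0 // mul1r expr2.
apply: le_trans (ler_pM _ _ q3 q3); rewrite ?ler0n //.
by rewrite -natrM ler_nat.
Qed.
Let p_lt1 : p < 1.
Proof. by apply: lt_le_trans p3; rewrite ltr_pMl // ltr1n. Qed.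
Let pX_le n : p ^+ n <= 1. Proof. by rewrite exprn_ile1 // ltW. Qed.

(** The induction needs the stronger bound (1 + p^k)/2, which propagates because 3p <= 1. *)
Lemma pochhammer_ge_half k : 1 / 2 <= pochhammer p k.
Proof.
suff h : (1 + p ^+ k) / 2 <= pochhammer p k.
  by apply: le_trans h; rewrite ler_pM2r ?invr_gt0 ?ltr0n // lerDl exprn_ge0 // ltW.
elim: k => [|k IH]; first by rewrite pochhammer0 expr0 divff // pnatr_eq0.
rewrite pochhammerS; apply: le_trans (_ : (1 + p ^+ k) / 2 * (1 - p ^+ k.+1) <= _); last first.
  by rewrite ler_wpM2r // subr_ge0.
rewrite mulrAC ler_pM2r ?invr_gt0 ?ltr0n // -subr_ge0.
have -> : (1 + p ^+ k) * (1 - p ^+ k.+1) - (1 + p ^+ k.+1)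
   = p ^+ k * (1 - 3 * p + p * (1 - p ^+ k)) by rewrite exprS; ring.
have p0 := ltW p_gt0; apply: mulr_ge0; first exact: exprn_ge0.
by apply: addr_ge0; [rewrite subr_ge0 | rewrite mulr_ge0 ?subr_ge0].
Qed.

Lemma pochhammer_unit k : pochhammer p k != 0.
Proof. by rewrite gt_eqF // (lt_le_trans _ (pochhammer_ge_half k)) // divr_gt0 ?ltr0n. Qed.

                                                                               
(** The powers of q combine to q^(-(k-l)^2); this unreduced form is what the involution count
    produces. *)
Definition theta_coef k l : K :=
  q ^+ ((k + l) ^ 2) /
  (q ^+ (2 * k ^ 2) * q ^+ (2 * l ^ 2) * pochhammer p k * pochhammer p l).

(** The exponent of q is at most 0, and each inverse Pochhammer symbol is at most 2. *)
Lemma theta_coef_bound k l : `|theta_coef k l| <= 4.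
Proof.
have pos n : 0 <= pochhammer p n.
  by apply: le_trans (pochhammer_ge_half n); rewrite divr_ge0 ?ler0n.
rewrite ger0_norm; last by rewrite divr_ge0 ?mulr_ge0 ?exprn_ge0 // ltW.
have half_inv n : (pochhammer p n)^-1 <= 2.
  rewrite -[leRHS]invrK lef_pV2 ?posrE ?invr_gt0 ?ltr0n //.
    by rewrite -div1r pochhammer_ge_half.
  by apply: lt_le_trans (pochhammer_ge_half n); rewrite divr_gt0 ?ltr0n.
have inv_ge0 n : 0 <= (pochhammer p n)^-1.
  by rewrite invr_ge0; apply: le_trans (pochhammer_ge_half n); rewrite divr_ge0 ?ler0n.
have -> : theta_coef k l = q ^+ ((k + l) ^ 2) / q ^+ (2 * k ^ 2 + 2 * l ^ 2)
     * ((pochhammer p k)^-1 * (pochhammer p l)^-1).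
  by rewrite /theta_coef exprD !invfM !mulrA.
rewrite -[4]mul1r (_ : 4 = 2 * 2); last by rewrite -natrM.
apply: ler_pM; rewrite ?divr_ge0 ?mulr_ge0 ?exprn_ge0 ?(ltW q_gt0) //.
  rewrite ler_pdivrMr ?exprn_gt0 // mul1r ler_weXn2l ?(ltW q_gt1) //.
  by case: (leqP k l) => [|/ltnW] /subnKC <-; rewrite !expnS !expn0; nia.
by apply: ler_pM.
Qed.

Lemma theta_coef0 : theta_coef 0 0 = 1.
Proof. by rewrite /theta_coef !pochhammer0 !expr0 !mulr1 divr1. Qed.

Lemma theta_coefSl k l :
  p ^+ l * (1 - p ^+ k.+1) * theta_coef k.+1 l = p ^+ k / q * theta_coef k l.
Proof.
rewrite /theta_coef pochhammerS.
have := pochhammer_unit k.+1; rewrite pochhammerS mulf_eq0 negb_or => /andP[].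
have := pochhammer_unit l.
have pE n : p ^+ n = (q ^+ n ^+ 2)^-1 by rewrite /p exprVn -!exprM mulnC.
have -> : q ^+ ((k.+1 + l) ^ 2) = q ^+ ((k + l) ^ 2) * q ^+ k ^+ 2 * q ^+ l ^+ 2 * q.
  by rewrite -!exprM -!exprD -exprSr; congr (q ^+ _); lia.
have -> : q ^+ (2 * k.+1 ^ 2) = q ^+ (2 * k ^ 2) * q ^+ k ^+ 4 * q ^+ 2.
  by rewrite -!exprM -!exprD; congr (q ^+ _); lia.
have a0 : q ^+ k != 0 by rewrite expf_neq0.
have b0 : q ^+ l != 0 by rewrite expf_neq0.
have c0 : q ^+ (2 * k ^ 2) != 0 by rewrite expf_neq0.
have d0 : q ^+ (2 * l ^ 2) != 0 by rewrite expf_neq0.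
rewrite !pE.
move: (1 - _) (pochhammer p k) (pochhammer p l) (q ^+ ((k + l) ^ 2)) (q ^+ k) (q ^+ l)
  (q ^+ (2 * k ^ 2)) (q ^+ (2 * l ^ 2)) a0 b0 c0 d0 => x y z t a b c d a0 b0 c0 d0 z0 y0 x0.
by field; rewrite a0 b0 c0 d0 z0 y0 x0 q_neq0.
Qed.

Lemma theta_coefC k l : theta_coef k l = theta_coef l k.
Proof. by rewrite /theta_coef addnC; congr (_ / _); ring. Qed.

Lemma theta_coefSS k l :
  (1 - p ^+ k.+1) * (1 - p ^+ l.+1) * theta_coef k.+1 l.+1 = theta_coef k l.
Proof.
have pl0 n : p ^+ n != 0 by rewrite expf_neq0 // gt_eqF.
apply: (mulfI (pl0 l.+1)); apply: (mulfI (pl0 k)).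
have h1 := theta_coefSl k l.+1; have h2 := theta_coefSl l k.
rewrite ![theta_coef _ k]theta_coefC in h2.
transitivity (p ^+ k * (1 - p ^+ l.+1) * (p ^+ l.+1 * (1 - p ^+ k.+1) * theta_coef k.+1 l.+1)).
  by ring.
rewrite h1.
have -> : p ^+ k * (1 - p ^+ l.+1) * (p ^+ k / q * theta_coef k l.+1)
  = p ^+ k / q * (p ^+ k * (1 - p ^+ l.+1) * theta_coef k l.+1) by ring.
rewrite h2 !exprS /p; by field.
Qed.

(** Grouping by total degree k + l = n turns the double series into a single one. *)
Definition antidiag (f : nat -> nat -> K) n : K := \sum_(k < n.+1) f k (n - k)%N.

Lemma antidiagSl (f g : nat -> nat -> K) n :
  (forall l, f 0%N l = 0) -> (forall k l, f k.+1 l = g k l) ->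
  antidiag f n.+1 = antidiag g n.
Proof.
move=> f0 fS; rewrite /antidiag big_ord_recl f0 add0r.
by apply: eq_bigr => k _; rewrite /= /bump add1n subSS fS.
Qed.

Lemma antidiagSr (f g : nat -> nat -> K) n :
  (forall k, f k 0%N = 0) -> (forall k l, f k l.+1 = g k l) ->
  antidiag f n.+1 = antidiag g n.
Proof.
move=> f0 fS; rewrite /antidiag big_ord_recr /= subnn f0 addr0.
by apply: eq_bigr => k _; rewrite /= subSn ?fS // -ltnS.
Qed.

Lemma antidiagZ x (f : nat -> nat -> K) n :
  antidiag (fun k l => x * f k l) n = x * antidiag f n.
Proof. by rewrite /antidiag mulr_sumr. Qed.

Lemma eq_antidiag (f g : nat -> nat -> K) n : (forall k l, f k l = g k l) ->
  antidiag f n = antidiag g n.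
Proof. by move=> fg; apply: eq_bigr => k _. Qed.

Lemma antidiagD (f g : nat -> nat -> K) n :
  antidiag (fun k l => f k l + g k l) n = antidiag f n + antidiag g n.
Proof. exact: big_split. Qed.

Section Recurrences.
Variables A B : K.

Let w k l := A ^+ k * B ^+ l * theta_coef k l.
Definition theta_term := antidiag w.
Definition theta_left := antidiag (fun k l => p ^+ k * w k l).
Definition theta_right := antidiag (fun k l => p ^+ l * w k l).

Lemma theta_termX n : p ^+ n * theta_term n = antidiag (fun k l => p ^+ k * p ^+ l * w k l) n.
Proof.
rewrite -antidiagZ; apply: eq_bigr => k _.
by rewrite -exprD subnKC // -ltnS.
Qed.

(** The difference of the first two antidiagonals has the factor 1 - p^k, which vanishes at k = 0
    and allows the index shift by [theta_coefSl]. *)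
Lemma theta_rightS n :
  theta_right n.+1 = p ^+ n.+1 * theta_term n.+1 + A / q * theta_left n.
Proof.
rewrite theta_termX -antidiagZ.
rewrite -(@antidiagSl (fun k l => p ^+ l * (1 - p ^+ k) * w k l) _ n) => [|l|k l].
- by rewrite -antidiagD; apply: eq_antidiag => k l; ring.
- by rewrite expr0 subrr mulr0 mul0r.
rewrite /w.
transitivity (A ^+ k.+1 * B ^+ l * (p ^+ l * (1 - p ^+ k.+1) * theta_coef k.+1 l)).
  by ring.
by rewrite theta_coefSl exprS; ring.
Qed.

Lemma theta_leftS n :
  theta_left n.+1 = p ^+ n.+1 * theta_term n.+1 + B / q * theta_right n.
Proof.
rewrite theta_termX -antidiagZ.
rewrite -(@antidiagSr (fun k l => p ^+ k * (1 - p ^+ l) * w k l) _ n) => [|k|k l].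
- by rewrite -antidiagD; apply: eq_antidiag => k l; ring.
- by rewrite expr0 subrr mulr0 mul0r.
rewrite /w.
transitivity (A ^+ k * B ^+ l.+1 * (p ^+ k * (1 - p ^+ l.+1) * theta_coef l.+1 k)).
  by rewrite [theta_coef l.+1 k]theta_coefC; ring.
by rewrite theta_coefSl [theta_coef l k]theta_coefC exprS; ring.
Qed.

(** The weight (1 - p^k)(1 - p^l) vanishes on both axes, so both indices shift by one. *)
Lemma theta_termSS n : theta_term n.+2 + p ^+ n.+2 * theta_term n.+2 =
  theta_left n.+2 + theta_right n.+2 + A * B * theta_term n.
Proof.
rewrite theta_termX -antidiagZ.
rewrite -(@antidiagSl (fun k l => (1 - p ^+ k) * (1 - p ^+ l.+1) * w k l.+1) _ n) => [|l|k l].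
- rewrite -(@antidiagSr (fun k l => (1 - p ^+ k) * (1 - p ^+ l) * w k l) _ n.+1) => [|k|//].
    by rewrite -!antidiagD; apply: eq_antidiag => k l; ring.
  by rewrite expr0 subrr mulr0 mul0r.
- by rewrite expr0 subrr !mul0r.
rewrite /w.
transitivity (A ^+ k.+1 * B ^+ l.+1 * ((1 - p ^+ k.+1) * (1 - p ^+ l.+1) * theta_coef k.+1 l.+1)).
  by ring.
by rewrite theta_coefSS !exprS; ring.
Qed.

Lemma antidiag0 (f : nat -> nat -> K) : antidiag f 0 = f 0%N 0%N.
Proof. by rewrite /antidiag big_ord1. Qed.

Lemma theta_term0 : theta_term 0 = 1.
Proof. by rewrite /theta_term antidiag0 /w theta_coef0 !expr0 !mulr1. Qed.

Lemma theta_left0 : theta_left 0 = 1.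
Proof. by rewrite /theta_left antidiag0 /w theta_coef0 !expr0 !mulr1. Qed.

Lemma theta_right0 : theta_right 0 = 1.
Proof. by rewrite /theta_right antidiag0 /w theta_coef0 !expr0 !mulr1. Qed.

Lemma theta_term1 : theta_term 1 + p * theta_term 1 = theta_left 1 + theta_right 1.
Proof.
rewrite theta_leftS theta_rightS theta_left0 theta_right0 !mulr1 expr1.
rewrite /theta_term /antidiag !big_ord_recl big_ord0 /= /w /bump /= subn0 !addr0.
have := theta_coefSl 0 0; rewrite !expr0 expr1 theta_coef0 !mulr1 !mul1r => e.
have e' := e; rewrite theta_coefC in e'.
have -> : A / q = A * ((1 - p) * theta_coef 1 0) by rewrite e.
have -> : B / q = B * ((1 - p) * theta_coef 0 1) by rewrite e'.
rewrite !expr1; ring.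
Qed.

Variable r : K.
Hypotheses (r0 : 0 <= r) (Ar : `|A| <= r) (Br : `|B| <= r).

Lemma antidiag_bound (f : nat -> nat -> K) n :
  (forall k l, `|f k l| <= `|w k l|) -> `|antidiag f n| <= n.+1%:R * (4 * r ^+ n).
Proof.
move=> fw; apply: le_trans (ler_norm_sum _ _ _) _.
rewrite mulr_natl -[n.+1 in leRHS](card_ord n.+1) -sumr_const; apply: ler_sum => k _.
apply: le_trans (fw _ _) _; have kn : (k <= n)%N by rewrite -ltnS.
rewrite /w normrM mulrC; apply: ler_pM => //; first exact: theta_coef_bound.
rewrite -[in leRHS](subnKC kn) exprD normrM !normrX.
by apply: ler_pM; rewrite ?exprn_ge0 // lerXn2r ?nnegrE.
Qed.

Lemma geometric_sum_le (s : K) n : 0 <= s < 1 -> \sum_(i < n) s ^+ i <= (1 - s)^-1.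
Proof.
move=> /andP[s0 s1]; have s10 : 0 < 1 - s by rewrite subr_gt0.
rewrite -[leRHS]mul1r ler_pdivlMr // mulrC -[_ * _]opprK -mulNr opprB -subrX1.
by rewrite opprB gerBl exprn_ge0.
Qed.

Variable s : K.
Hypotheses (r_lt_s : r < s) (s_lt1 : s < 1).

Let s_gt0 : 0 < s. Proof. exact: le_lt_trans r_lt_s. Qed.

Let M := 4 / (1 - r / s).

(** The polynomial factor n + 1 is absorbed by enlarging the ratio from r to s: (n + 1)(r/s)^n is at
    most the partial geometric sum of r/s. *)
Lemma antidiag_geometric (f : nat -> nat -> K) n :
  (forall k l, `|f k l| <= `|w k l|) -> `|antidiag f n| <= M * s ^+ n.
Proof.
move=> /(antidiag_bound n) h; apply: le_trans h _.
have t0 : 0 <= r / s by rewrite divr_ge0 // ltW.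
have t1 : r / s < 1 by rewrite ltr_pdivrMr // mul1r.
have -> : n.+1%:R * (4 * r ^+ n) = 4 * (n.+1%:R * (r / s) ^+ n) * s ^+ n.
  have := expf_neq0 n (lt0r_neq0 s_gt0); rewrite expr_div_n.
  by move: (s ^+ n) => t tn0; field.
rewrite ler_pM2r ?exprn_gt0 // /M ler_pM2l ?ltr0n //.
apply: le_trans (geometric_sum_le n.+1 _); last by rewrite t0.
rewrite mulr_natl -[n.+1 in leLHS](card_ord n.+1) -sumr_const; apply: ler_sum => k _.
by rewrite ler_wiXn2l // ?(ltW t1) // -ltnS.
Qed.

Hypothesis dominated_cvg : forall (a : nat -> K) (c t : K), 0 <= t < 1 ->
  (forall n, `|a n| <= c * t ^+ n) -> cvgn (series a).

Lemma series_shift (a b : nat -> K) (c l : K) : a 0%N = 0 ->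
  (forall n, a n.+1 = c * b n) -> series b @ \oo --> l -> series a @ \oo --> c * l.
Proof.
move=> a0 aS bl; rewrite -cvg_shiftS.
rewrite (_ : [sequence _]_n = (fun n => c * series b n)); last first.
  apply/funext => n; rewrite /series /= big_nat_recl // a0 add0r mulr_sumr.
  by apply: eq_bigr => i _.
by apply: cvgMl_tmp.
Qed.

Definition theta : K := limn (series theta_term).

Let s_pos_lt1 : 0 <= s < 1. Proof. by rewrite ltW. Qed.

Lemma cvg_theta : series theta_term @ \oo --> theta.
Proof.
by apply: (dominated_cvg s_pos_lt1) => n; exact: antidiag_geometric.
Qed.

End Recurrences.

Section FunctionalEquation.
Variables (r s : K).
Hypotheses (r0 : 0 <= r) (r_lt_s : r < s) (s_lt1 : s < 1).
Hypothesis dominated_cvg : forall (a : nat -> K) (c t : K), 0 <= t < 1 ->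
  (forall n, `|a n| <= c * t ^+ n) -> cvgn (series a).

(** Let x, y be the sums weighted by p^k and p^l, t = theta(A, B) and t' = theta(pA, pB). The
    relations y - t' = (A/q) x, x - t' = (B/q) y and t + t' - x - y = AB t determine t from t'. *)
Lemma theta_functional A B : `|A| <= r -> `|B| <= r ->
  theta A B * ((1 - A * B) * (1 - A * B * p))
    = (1 + A / q) * (1 + B / q) * theta (p * A) (p * B).
Proof.
move=> Ar Br; have s_pos_lt1 : 0 <= s < 1 by rewrite s_lt1 (le_trans r0) ?ltW.
have bnd := antidiag_geometric r0 Ar Br r_lt_s.
have pX_norm_le n x : `|p ^+ n * x| <= `|x|.
  by rewrite normrM ler_piMl // normrX exprn_ile1 // ger0_norm ?ltW.
have cT : series (theta_term A B) @ \oo --> theta A B.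
  exact: (cvg_theta r0 Ar Br r_lt_s s_lt1 dominated_cvg).
have cL : cvgn (series (theta_left A B)).
  by apply: (dominated_cvg s_pos_lt1) => n; apply: bnd.
have cR : cvgn (series (theta_right A B)).
  by apply: (dominated_cvg s_pos_lt1) => n; apply: bnd.
have homog n : theta_term (p * A) (p * B) n = p ^+ n * theta_term A B n.
  rewrite -antidiagZ; apply: eq_bigr => k _.
  have kn : (k <= n)%N by rewrite -ltnS.
  have -> : p ^+ n = p ^+ k * p ^+ (n - k) by rewrite -exprD subnKC.
  by rewrite !exprMn; ring.
have cT' : series (fun n => p ^+ n * theta_term A B n) @ \oo --> theta (p * A) (p * B).
  have -> : (fun n => p ^+ n * theta_term A B n) = theta_term (p * A) (p * B).
    by apply/funext => n; rewrite homog.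
  apply: (cvg_theta r0 _ _ r_lt_s s_lt1 dominated_cvg).
    by apply: le_trans Ar; have := pX_norm_le 1%N A; rewrite expr1.
  by apply: le_trans Br; have := pX_norm_le 1%N B; rewrite expr1.
move: cL cR; set x := limn (series (theta_left A B)); set y := limn (series (theta_right A B)).
move=> cL cR.
have seriesB (a b : nat -> K) la lb : series a @ \oo --> la -> series b @ \oo --> lb ->
    series (fun n => a n - b n) @ \oo --> la - lb.
  move=> ha hb; have -> : series (fun n => a n - b n) = series a \- series b.
    by apply/funext => n; rewrite /series /= sumrB.
  exact: cvgB.
have seriesD' (a b : nat -> K) la lb : series a @ \oo --> la -> series b @ \oo --> lb ->
    series (fun n => a n + b n) @ \oo --> la + lb.
  move=> ha hb; have -> : series (fun n => a n + b n) = series a \+ series b.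
    by apply/funext => n; rewrite /series /= big_split.
  exact: cvgD.
have yE : y - theta (p * A) (p * B) = A / q * x.
  apply: (@cvg_unique _ _ _ _ _ _ (seriesB _ _ _ _ cR cT')) => //.
  apply: series_shift cL => [|n].
    by rewrite theta_right0 theta_term0 expr0 mulr1 subrr.
  by rewrite theta_rightS addrAC subrr add0r.
have xE : x - theta (p * A) (p * B) = B / q * y.
  apply: (@cvg_unique _ _ _ _ _ _ (seriesB _ _ _ _ cL cT')) => //.
  apply: series_shift cR => [|n].
    by rewrite theta_left0 theta_term0 expr0 mulr1 subrr.
  by rewrite theta_leftS addrAC subrr add0r.
have tE : theta A B + theta (p * A) (p * B) - (x + y) = A * B * theta A B.
  have cD := seriesB _ _ _ _ (seriesD' _ _ _ _ cT cT') (seriesD' _ _ _ _ cL cR).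
  apply: (@cvg_unique _ _ _ _ _ _ cD) => //.
  rewrite -[A * B * theta A B]mul1r.
  (* The relation shifts the degree by two, done as two single shifts through [f]. *)
  pose f n := if n is m.+1 then A * B * theta_term A B m else 0.
  apply: (@series_shift _ f) => [|[|n]|].
  - by rewrite theta_left0 theta_right0 theta_term0 expr0 mulr1 subrr.
  - by rewrite /f expr1 theta_term1 subrr mulr0.
  - by rewrite theta_termSS addrAC subrr add0r mul1r.
  by apply: (@series_shift f (theta_term A B)).
move: xE yE tE; move: (theta A B) (theta (p * A) (p * B)) => t t' xE yE tE.
have x1 : x * (1 - A * B * p) = t' * (1 + B / q).
  have -> : x * (1 - A * B * p) = t' + (x - t') - A / q * x * (B / q).
    by rewrite /p; field.
  by rewrite -yE xE; ring.
have y1 : y * (1 - A * B * p) = t' * (1 + A / q).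
  have -> : y * (1 - A * B * p) = t' + (y - t') - B / q * y * (A / q).
    by rewrite /p; field.
  by rewrite -xE yE; ring.
have -> : t * ((1 - A * B) * (1 - A * B * p)) = (t - A * B * t) * (1 - A * B * p) by ring.
rewrite -tE.
have -> : (t - (t + t' - (x + y))) * (1 - A * B * p)
  = x * (1 - A * B * p) + y * (1 - A * B * p) - t' * (1 - A * B * p) by ring.
rewrite x1 y1 /p; by field.
Qed.

Let pX_norm_le n x : `|p ^+ n * x| <= `|x|.
Proof. by rewrite normrM ler_piMl // normrX exprn_ile1 // ger0_norm ?ltW. Qed.

Let s_pos_lt1 : 0 <= s < 1. Proof. by rewrite s_lt1 (le_trans r0) ?ltW. Qed.

(** One step multiplies AB by p^2, so each use of the functional equation consumes two factors of
    the left product. *)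
Lemma theta_iter A B N : `|A| <= r -> `|B| <= r ->
  theta A B * \prod_(i < 2 * N) (1 - A * B * p ^+ i) =
  \prod_(i < N) (1 + A / q * p ^+ i) * \prod_(i < N) (1 + B / q * p ^+ i)
    * theta (p ^+ N * A) (p ^+ N * B).
Proof.
move=> Ar Br; elim: N => [|N IH].
  by rewrite muln0 !big_ord0 expr0 !mul1r mulr1.
rewrite mulnS 2!big_ord_recr /= mulrA mulrA IH !big_ord_recr /=.
have ArN : `|p ^+ N * A| <= r by apply: le_trans Ar.
have BrN : `|p ^+ N * B| <= r by apply: le_trans Br.
have FE := theta_functional ArN BrN.
have pE : (1 - A * B * p ^+ (2 * N)) * (1 - A * B * p ^+ (2 * N).+1)
   = (1 - (p ^+ N * A) * (p ^+ N * B)) * (1 - (p ^+ N * A) * (p ^+ N * B) * p).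
  by rewrite exprS mulnC exprM; ring.
rewrite -[LHS]mulrA pE -[LHS]mulrA FE exprS -[p * p ^+ N * A]mulrA -[p * p ^+ N * B]mulrA.
by ring.
Qed.

Lemma cvg_pX : (fun n => p ^+ n) @ \oo --> (0 : K).
Proof.
apply: cvg_series_cvg_0; apply: (@dominated_cvg _ 1 p) => [|n].
  by rewrite p_lt1 ltW.
by rewrite mul1r ger0_norm // exprn_ge0 // ltW.
Qed.

Lemma cvg_theta_scale A B : `|A| <= r -> `|B| <= r ->
  (fun N => theta (p ^+ N * A) (p ^+ N * B)) @ \oo --> (1 : K).
Proof.
move=> Ar Br; have s1 : 0 < 1 - s by rewrite subr_gt0.
have s0 : 0 < s by apply: le_lt_trans r_lt_s.
(* The sum of the geometric majorants; after removal of the constant term 1, every term carries at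
   least one factor p^N. *)
pose c := 4 / (1 - r / s) / (1 - s).
have c0 : 0 < c by rewrite !divr_gt0 ?ltr0n // subr_gt0 ltr_pdivrMr // mul1r.
have bound N : `|theta (p ^+ N * A) (p ^+ N * B) - 1| <= 2 * (p ^+ N * c).
  have ArN : `|p ^+ N * A| <= r by apply: le_trans Ar.
  have BrN : `|p ^+ N * B| <= r by apply: le_trans Br.
  have := cvg_theta r0 ArN BrN r_lt_s s_lt1 dominated_cvg.
  rewrite -cvg_shiftS => /lim_dist_le; apply => [|n].
    by rewrite mulr_gt0 ?exprn_gt0.
  rewrite /series /= big_nat_recl // theta_term0 addrC addrA addNr add0r.
  apply: le_trans (ler_norm_sum _ _ _) _.
  apply: le_trans (_ : \sum_(0 <= i < n) p ^+ N * (4 / (1 - r / s) * s ^+ i) <= _).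
    apply: ler_sum => i _.
    have -> : theta_term (p ^+ N * A) (p ^+ N * B) i.+1 = p ^+ N ^+ i.+1 * theta_term A B i.+1.
      rewrite -antidiagZ; apply: eq_bigr => k _.
      have kn : (k <= i.+1)%N by rewrite -ltnS.
      have -> : p ^+ N ^+ i.+1 = p ^+ N ^+ k * p ^+ N ^+ (i.+1 - k) by rewrite -exprD subnKC.
      by rewrite !exprMn; ring.
    rewrite normrM; apply: ler_pM => //.
      rewrite normrX ger0_norm ?exprn_ge0 ?(ltW p_gt0) // exprS.
      by rewrite ler_piMr ?exprn_ge0 ?exprn_ile1 ?exprn_ge0 // ltW.
    apply: le_trans (antidiag_geometric r0 Ar Br r_lt_s _ (fun k l => lexx _)) _.
    rewrite ler_pM2l; last by rewrite divr_gt0 ?ltr0n // subr_gt0 ltr_pdivrMr // mul1r.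
    by rewrite exprS ler_piMl ?exprn_ge0 // ltW.
  rewrite -!mulr_sumr ler_pM2l ?exprn_gt0 // /c ler_pM2l.
    by rewrite big_mkord geometric_sum_le.
  by rewrite divr_gt0 ?ltr0n // subr_gt0 ltr_pdivrMr // mul1r.
apply/cvgrPdist_lt => e e0.
have c2 : 0 < 2 * c by rewrite pmulr_rgt0 // ltr0n.
have d0 : 0 < e / (2 * c) by rewrite divr_gt0.
have /cvgr0Pnorm_lt/(_ _ d0) := cvg_pX; apply: filterS => N.
rewrite ger0_norm ?exprn_ge0 ?(ltW p_gt0) // ltr_pdivlMr // => h.
by rewrite distrC; apply: le_lt_trans (bound N) _; rewrite mulrCA.
Qed.

(** Taking B = 0 in [theta_iter] leaves a single product, so theta itself provides its limit. The
    limit is nonzero because the finite products are, and theta(p^N z, 0) is near 1 for large N. *)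
Lemma cvg_pochhammer_tail z : `|z| <= r ->
  exists2 l : K, l != 0 & (fun N => \prod_(i < N) (1 + z / q * p ^+ i)) @ \oo --> l.
Proof.
move=> zr; have z0 : `|0 : K| <= r by rewrite normr0.
pose P N := \prod_(i < N) (1 + z / q * p ^+ i).
have cS := cvg_theta_scale zr z0.
have itE N : theta z 0 = P N * theta (p ^+ N * z) (p ^+ N * 0).
  have := theta_iter N zr z0; rewrite big1 => [|i _]; last by rewrite mulr0 mul0r subr0.
  by rewrite mulr1 => ->; rewrite [X in _ * X * _]big1 ?mulr1 // => i _; rewrite !mul0r addr0.
have P0 N : P N != 0.
  apply/prodf_neq0 => i _; rewrite addr_eq0.
  apply/negP => /eqP /(congr1 Num.norm); rewrite normr1 normrN mulrC => e.
  have : `|p ^+ i * (z / q)| < 1.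
    apply: le_lt_trans (pX_norm_le _ _) _; rewrite normrM normfV (ger0_norm (ltW q_gt0)).
    rewrite ltr_pdivrMr // mul1r; apply: le_lt_trans zr _.
    by apply: lt_trans r_lt_s _; apply: lt_trans s_lt1 _.
  by rewrite -e ltxx.
have S1 : \forall N \near \oo, theta (p ^+ N * z) (p ^+ N * 0) != 0.
  have /cvgrPdist_lt/(_ _ ltr01) := cS; apply: filterS => N.
  by apply: contraTneq => ->; rewrite subr0 normr1 ltxx.
exists (theta z 0).
  have [N _ /(_ N (leqnn N)) /= SN] := S1.
  by rewrite (itE N) mulf_neq0.
have -> : theta z 0 = theta z 0 * 1^-1 by rewrite invr1 mulr1.
apply: cvg_trans (cvgM (cvg_cst (theta z 0)) (cvgV (oner_neq0 K) cS)).
apply: near_eq_cvg; apply: filterS S1 => N SN /=.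
by rewrite /cst (itE N) mulfK.
Qed.

(** The factor 1 + z is split off, and the rest is the previous product with z / q in place of z. *)
Lemma cvg_qprod z : `|z| <= r ->
  exists2 l : K, l != 0 & (fun N => \prod_(i < N) (1 + z * p ^+ i)) @ \oo --> l.
Proof.
move=> zr; have zqr : `|z / q| <= r.
  rewrite normrM normfV (ger0_norm (ltW q_gt0)) ler_pdivrMr //.
  by apply: le_trans zr _; rewrite ler_peMr // ltW.
have [l l0 cl] := cvg_pochhammer_tail zqr.
exists ((1 + z) * l).
  rewrite mulf_neq0 // addr_eq0; apply/negP => /eqP /(congr1 Num.norm).
  rewrite normr1 normrN => e; have := le_lt_trans zr (lt_trans r_lt_s s_lt1).
  by rewrite -e ltxx.
by apply: cvg_qprod_shift; have -> : z * p = z / q / q by rewrite /p; field.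
Qed.

Lemma cvg_mul2n (f : nat -> K) (l : K) : f @ \oo --> l -> (fun n => f (2 * n)%N) @ \oo --> l.
Proof.
move=> fl A /fl [N _ fN]; exists N => // n /= Nn; apply: fN => /=.
by apply: leq_trans Nn _; rewrite leq_pmull.
Qed.

Lemma theta_product (A B lA lB l : K) : `|A| <= r -> `|B| <= r -> l != 0 ->
  (fun N => \prod_(i < N) (1 + A / q * p ^+ i)) @ \oo --> lA ->
  (fun N => \prod_(i < N) (1 + B / q * p ^+ i)) @ \oo --> lB ->
  (fun N => \prod_(i < N) (1 - A * B * p ^+ i)) @ \oo --> l ->
  series (theta_term A B) @ \oo --> lA * lB / l.
Proof.
move=> Ar Br l0 cA cB cl.
suff -> : lA * lB / l = theta A B by exact: (cvg_theta r0 Ar Br r_lt_s s_lt1 dominated_cvg).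
apply: (canLR (mulfK l0)); rewrite -[LHS]mulr1.
have h1 : (fun N => \prod_(i < N) (1 + A / q * p ^+ i) * \prod_(i < N) (1 + B / q * p ^+ i)
    * theta (p ^+ N * A) (p ^+ N * B)) @ \oo --> lA * lB * 1.
  exact: cvgM (cvgM cA cB) (cvg_theta_scale Ar Br).
have h2 : (fun N => theta A B * \prod_(i < 2 * N) (1 - A * B * p ^+ i)) @ \oo --> theta A B * l.
  exact: cvgMl_tmp (cvg_mul2n cl).
apply: (@cvg_unique _ _ _ _ _ _ h1) => //.
move: h2; apply: cvg_trans; apply: near_eq_cvg; apply: nearW => N /=.
by rewrite /cst (theta_iter N Ar Br).
Qed.

End FunctionalEquation.
End ThetaSeries.

                                                             

(** * Gram matrices of the three quadratic forms *)

Section GramMatrices.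
Variable F : finFieldType.
Hypothesis odd_q : odd #|F|.

Lemma coordinate_row_mx m n (a : 'rV[F]_m) (v : 'rV[F]_n) k :
  coordinate (row_mx a v) (m + k) = coordinate v k.
Proof.
rewrite /coordinate; case: insubP => [i _ ik|]; case: insubP => [j _ jk|].
- rewrite -[RHS](row_mxEr a); congr (row_mx a v _ _); apply: val_inj => /=.
  by rewrite ik jk.
- by rewrite -leqNgt => nk; have := ltn_ord i; rewrite ik ltn_add2l ltnNge nk.
- by rewrite ltn_add2l -jk ltn_ord.
- by [].
Qed.

Lemma coordinate_row_mxl m n (a : 'rV[F]_m) (v : 'rV[F]_n) (i : 'I_m) :
  coordinate (row_mx a v) i = a 0 i.
Proof.
rewrite /coordinate; case: insubP => [j _ ji|]; last by rewrite ltn_addr.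
by rewrite -[RHS](row_mxEl a v); congr (row_mx a v _ _); apply: val_inj.
Qed.

                                                                                
                                             
(** The common shape of the three forms: n hyperbolic planes plus a diagonal form of rank r = 0, 1
    or 2. *)
Definition hyperbolic_diag r (c : 'I_r -> F) m n (v : 'rV[F]_m) : F :=
  hyperbolic_sum n v + \sum_(i < r) c i * coordinate v (2 * n + i) ^+ 2.

Lemma coordinate_ord m (v : 'rV[F]_m) (i : 'I_m) : coordinate v i = v 0 i.
Proof.
rewrite /coordinate; case: insubP => [j _ ji|]; last by rewrite ltn_ord.
by congr (v 0 _); apply: val_inj.
Qed.

(** S is the polar form, so it takes the value 2Q(v) at v; each hyperbolic plane contributes -1 to
    the determinant. *)
Lemma gram_exists r (c : 'I_r -> F) n m : m = (2 * n + r)%N ->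
  exists S : 'M[F]_m, [/\ S^T = S, \det S = (-1) ^+ n * \prod_(i < r) (2 * c i) &
    forall v, v *m S *m v^T = (2 * hyperbolic_diag c n v)%:M].
Proof.
elim: n m => [|n IH] m em.
  rewrite muln0 add0n in em; subst m.
  exists (diag_mx (\row_i (2 * c i))); split.
  - by rewrite tr_diag_mx.
  - by rewrite det_diag expr0 mul1r; apply: eq_bigr => i _; rewrite mxE.
  move=> v; rewrite [LHS]mx11_scalar; congr (_%:M).
  rewrite /hyperbolic_diag /hyperbolic_sum big_ord0 add0r mulr_sumr mxE.
  apply: eq_bigr => i _; rewrite muln0 add0n coordinate_ord mul_mx_diag !mxE.
  by ring.
have [S [sS dS vS]] := IH _ erefl.
have {em} em : m = (2 + (2 * n + r))%N by rewrite em mulnS addnA.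
subst m; pose H : 'M[F]_2 := \matrix_(i, j) (i != j)%:R.
exists (block_mx H 0 0 S); split.
- rewrite tr_block_mx !trmx0 sS; congr (block_mx _ _ _ _).
  by apply/matrixP => i j; rewrite !mxE eq_sym.
- rewrite det_ublock dS (expand_det_row _ ord0) !big_ord_recl big_ord0.
  rewrite /cofactor !det_mx11 !mxE /= exprS; ring.
move=> v; rewrite -[v]hsubmxK; set a := lsubmx v; set w := rsubmx v.
rewrite tr_row_mx mul_row_block !mulmx0 addr0 add0r mul_row_col vS.
rewrite [a *m H *m a^T]mx11_scalar -raddfD /=; congr (_%:M).
rewrite /hyperbolic_diag mulrDr [RHS]mulrDr addrA; congr (_ + _); last first.
  congr (_ * _); apply: eq_bigr => i _; congr (_ * _ ^+ 2).
  by rewrite mulnS -addnA coordinate_row_mx.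
rewrite /hyperbolic_sum big_ord_recl mulrDr; congr (_ + _); last first.
  congr (_ * _); apply: eq_bigr => i _.
  rewrite /= /bump /= add1n mulnS -[(2 + 2 * i).+1]/(2 + (2 * i).+1)%N.
  by rewrite !coordinate_row_mx.
have -> : coordinate (row_mx a w) (2 * @ord0 n) = a 0 0.
  by rewrite -(coordinate_row_mxl a w).
have -> : coordinate (row_mx a w) (2 * @ord0 n).+1 = a 0 1.
  by rewrite -(coordinate_row_mxl a w).
rewrite !mxE !big_ord_recl !big_ord0 !mxE !big_ord_recl !big_ord0 !mxE /=.
have -> : lift ord0 ord0 = 1 :> 'I_2 by apply: val_inj.
by rewrite /=; ring.
Qed.

(** If g preserves Q, the symmetric matrix g S g^T - S has only zero values, hence is 0 by
    [sym_anisotropic]. *)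
Lemma isometries_form_stab m (Q : 'rV[F]_m -> F) (S : 'M[F]_m) : S^T = S ->
  (forall v, v *m S *m v^T = (2 * Q v)%:M) -> isometries Q = form_stab S.
Proof.
move=> sS QS; apply/setP => g; rewrite !inE; congr (_ && _).
have two0 := odd_card_two_neq0 odd_q.
apply/forallP/eqP => [Qg|gS v].
  apply/eqP; rewrite -subr_eq0; apply/negPn/negP => D0.
  have [|v] := sym_anisotropic odd_q _ D0.
    by rewrite linearB /= !trmx_mul trmxK sS mulmxA.
  rewrite mulmxBr mulmxBl QS.
  have -> : v *m (g *m S *m g^T) *m v^T = (v *m g) *m S *m (v *m g)^T.
    by rewrite trmx_mul !mulmxA.
  by rewrite QS (eqP (Qg v)) subrr eqxx.
apply/eqP/(mulfI two0).
have : (2 * Q (v *m g))%:M = (2 * Q v)%:M :> 'M[F]_1.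
  by rewrite -!QS trmx_mul -[in RHS]gS !mulmxA.
by move/matrixP/(_ 0 0); rewrite !mxE eqxx !mulr1n.
Qed.

Lemma num_involutions_form_stab m (S : 'M[F]_m) :
  num_involutions (det1_part (form_stab S)) = #|special_involutions S|.
Proof. by apply: eq_card => g; rewrite !inE andbA. Qed.

End GramMatrices.

(** * The terms of both series as theta terms *)

Section Terms.
Variables (F : finFieldType) (K : numFieldType).
Hypothesis odd_q : odd #|F|.
Variable delta : F.
Hypothesis delta_nonsquare : forall x : F, x ^+ 2 != delta.
Let q : K := #|F|%:R.

Let q_neq0 : q != 0.
Proof. by rewrite pnatr_eq0 -lt0n (ltn_trans _ (card_finNzRing_gt1 F)). Qed.

Lemma sum_even_ord (f : nat -> K) n :
  \sum_(j < (2 * n).+1 | ~~ odd j) f j = \sum_(k < n.+1) f (2 * k)%N /\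
  \sum_(j < (2 * n).+2 | ~~ odd j) f j = \sum_(k < n.+1) f (2 * k)%N.
Proof.
have odd2 k : odd (2 * k) = false by rewrite mul2n odd_double.
have even_odd k : \sum_(j < (2 * k).+2 | ~~ odd j) f j = \sum_(j < (2 * k).+1 | ~~ odd j) f j.
  by rewrite [LHS]big_mkcond [RHS]big_mkcond big_ord_recr /= odd2 addr0.
rewrite even_odd.
suff -> : \sum_(j < (2 * n).+1 | ~~ odd j) f j = \sum_(k < n.+1) f (2 * k)%N by [].
elim: n => [|n IH]; first by rewrite muln0 big_mkcond !big_ord1.
rewrite mulnS big_mkcond big_ord_recr -big_mkcond even_odd IH [RHS]big_ord_recr /=.
by rewrite odd2 /= mulnS.
Qed.

(** With j = 2k and l = n - k, the counting part carries q^k q^l, hence the arguments uq, uq. In the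
    character part the signs (-1)^k and (-1)^l combine with det S to [sg]. *)
Lemma even_dim_ratio n (S : 'M[F]_(2 * n)) (sg u : K) : S^T = S -> \det S != 0 ->
  qchar K ((-1) ^+ n * \det S) = sg ->
  #|special_involutions S|%:R / #|form_stab S|%:R * q ^+ (n ^ 2) * u ^+ n
  = 1 / 2 * (theta_term q (u * q) (u * q) n + sg * theta_term q u u n).
Proof.
move=> sS dS sgE; rewrite (special_involutions_ratio K odd_q sS dS).
pose f j := (sym_sum (@is_nonzero F K) j / (gl_order F j)%:R
     * (sym_sum (@is_nonzero F K) (2 * n - j) / (gl_order F (2 * n - j))%:R)
   + qchar K (\det S) * (sym_sum (@qchar F K) j / (gl_order F j)%:R
     * (sym_sum (@qchar F K) (2 * n - j) / (gl_order F (2 * n - j))%:R))) / 2.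
rewrite (sum_even_ord f n).1 {}/f -mulrA mulr_suml /theta_term /antidiag.
rewrite [sg * _]mulr_sumr -big_split /= mulr_sumr; apply: eq_bigr => k _.
have kn : (k <= n)%N by rewrite -ltnS.
rewrite -mulnBr !(sym_count_ratio F K _).1 !(sym_qchar_ratio K _ delta_nonsquare) -/q.
have chi : qchar K (\det S) * (qchar K ((-1 : F) ^+ k) * qchar K ((-1 : F) ^+ (n - k))) = sg.
  by rewrite -!qcharM -exprD subnKC // mulrC sgE.
have un : u ^+ n = u ^+ k * u ^+ (n - k) by rewrite -exprD subnKC.
rewrite /theta_coef subnKC // un !exprMn -chi.
have := pochhammer_neq0 F K k; have := pochhammer_neq0 F K (n - k); rewrite -/q.
have : q ^+ (2 * k ^ 2) != 0 by rewrite expf_neq0.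
have : q ^+ (2 * (n - k) ^ 2) != 0 by rewrite expf_neq0.
move: (q ^+ (2 * k ^ 2)) (q ^+ (2 * (n - k) ^ 2)) (pochhammer _ k) (pochhammer _ (n - k)).
move: (u ^+ k) (u ^+ (n - k)) (q ^+ k) (q ^+ (n - k)) (q ^+ (n ^ 2)).
move: (qchar K (\det S)) (qchar K _) (qchar K _).
move=> x y z a b c d t e f g h f0 e0 h0 g0.
by field; rewrite e0 f0 g0 h0.
Qed.

(** Here m - j is odd, which kills the character part; the counting part carries q^k q^-l, hence the
    arguments uq and u/q. *)
Lemma odd_dim_ratio n (S : 'M[F]_((2 * n).+1)) (u : K) : S^T = S -> \det S != 0 ->
  #|special_involutions S|%:R / #|form_stab S|%:R * q ^+ (n ^ 2) * u ^+ n
  = 1 / 2 * theta_term q (u * q) (u / q) n.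
Proof.
move=> sS dS; rewrite (special_involutions_ratio K odd_q sS dS).
pose f j := (sym_sum (@is_nonzero F K) j / (gl_order F j)%:R
     * (sym_sum (@is_nonzero F K) ((2 * n).+1 - j) / (gl_order F ((2 * n).+1 - j))%:R)
   + qchar K (\det S) * (sym_sum (@qchar F K) j / (gl_order F j)%:R
     * (sym_sum (@qchar F K) ((2 * n).+1 - j) / (gl_order F ((2 * n).+1 - j))%:R))) / 2.
rewrite (sum_even_ord f n).2 {}/f -mulrA mulr_suml /theta_term /antidiag.
rewrite mulr_sumr; apply: eq_bigr => k _.
have kn : (k <= n)%N by rewrite -ltnS.
rewrite subSn ?leq_mul2l // -mulnBr (sym_count_ratio F K _).1 (sym_count_ratio F K _).2.
rewrite (sym_qchar_odd K _ delta_nonsquare) mul0r !mulr0 addr0 -/q.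
have un : u ^+ n = u ^+ k * u ^+ (n - k) by rewrite -exprD subnKC.
rewrite /theta_coef subnKC // un expr_div_n !exprMn.
have := pochhammer_neq0 F K k; have := pochhammer_neq0 F K (n - k); rewrite -/q.
have : q ^+ (2 * k ^ 2) != 0 by rewrite expf_neq0.
have : q ^+ (2 * (n - k) ^ 2) != 0 by rewrite expf_neq0.
have : q ^+ (n - k) != 0 by rewrite expf_neq0.
move: (q ^+ (2 * k ^ 2)) (q ^+ (2 * (n - k) ^ 2)) (pochhammer _ k) (pochhammer _ (n - k)).
move: (u ^+ k) (u ^+ (n - k)) (q ^+ k) (q ^+ (n - k)) (q ^+ (n ^ 2)).
move=> a b c d t e f g h d0 f0 e0 h0 g0.
by field; rewrite d0 e0 f0 g0 h0.
Qed.

Lemma even_termE s (u : K) n : even_term s delta u n =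
  1 / 2 * (theta_term q (u * q) (u * q) n + sign_val K s * theta_term q u u n).
Proof.
have sgn1 k : ((-1 : F) ^+ k) ^+ 2 = 1 by rewrite -exprM mulnC exprM sqrrN !expr1n.
have two0 := odd_card_two_neq0 odd_q.
have chi1 : qchar K (1 : F) = 1 by apply: weight1; exact: qchar_sqr.
have d0 : delta != 0 by rewrite eq_sym; have := delta_nonsquare 0; rewrite expr0n.
have chid : qchar K delta = -1.
  rewrite /qchar (negPf d0); case: squareP => // -[y e].
  by have := delta_nonsquare y; rewrite e eqxx.
rewrite /even_term -/q; case: s => /=.
  have [S [sS dS vS]] := @gram_exists F 0 (fun=> 0) n (2 * n) (esym (addn0 _)).
  rewrite big_ord0 mulr1 in dS.
  have QS : isometries (@form_plus F n) = form_stab S.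
    apply: isometries_form_stab => // v; rewrite vS; congr (2 * _)%:M.
    by rewrite /hyperbolic_diag big_ord0 addr0.
  rewrite /SO_even /= QS num_involutions_form_stab (@even_dim_ratio n S 1 u) //.
    by rewrite dS expf_neq0 // oppr_eq0 oner_neq0.
  by rewrite dS -expr2 sgn1 chi1.
(* At n = 0 the convention 1/|O^-(0, q)| = 0 agrees with the difference of the two constant terms
   1. *)
case: n => [|n].
  by rewrite mulr0 !mul0r !theta_term0 mulN1r subrr mulr0.
pose c (i : 'I_2) := if i == 0 then 1 else - delta.
have [S [sS dS vS]] := @gram_exists F 2 c n (2 * n.+1) (etrans (mulnS _ _) (addnC _ _)).
have QS : isometries (@form_minus F delta n.+1) = form_stab S.
  apply: isometries_form_stab => // v; rewrite vS; congr (2 * _)%:M.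
  rewrite /hyperbolic_diag /form_minus !big_ord_recl big_ord0 /c /= addn0 /bump /= addn1.
  by ring.
(* After removal of (-1)^(n+1) the determinant is 4 delta, a nonsquare, which gives the sign -1. *)
have dSE : \det S = (-1) ^+ n.+1 * (2 ^+ 2 * delta).
  rewrite dS !big_ord_recl big_ord0 /c /= exprS; ring.
rewrite /SO_even /= QS num_involutions_form_stab (@even_dim_ratio n.+1 S (-1) u) //.
  by rewrite dSE !mulf_neq0 // expf_neq0 // ?oppr_eq0 ?oner_neq0.
by rewrite dSE mulrA -expr2 sgn1 mul1r qcharM qchar_sqr // mul1r.
Qed.

Lemma odd_termE (u : K) n : odd_term F u n = 1 / 2 * theta_term q (u * q) (u / q) n.
Proof.
have two0 := odd_card_two_neq0 odd_q.
have [S [sS dS vS]] := @gram_exists F 1 (fun=> 1) n (2 * n).+1 (esym (addn1 _)).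
have QS : isometries (@form_odd F n) = form_stab S.
  apply: isometries_form_stab => // v; rewrite vS; congr (2 * _)%:M.
  by rewrite /hyperbolic_diag /form_odd big_ord1 mul1r addn0.
rewrite /odd_term /SO_odd /O_odd QS num_involutions_form_stab odd_dim_ratio //.
by rewrite dS big_ord1 !mulf_neq0 ?oner_neq0 // expf_neq0 // oppr_eq0 oner_neq0.
Qed.

End Terms.

Lemma double_pred (j : nat) : 2 * (j.+1%:Z - 1) = (2 * j)%N.
Proof. lia. Qed.

Lemma double_pred2 (j : nat) : 2 * (j.+2%:Z - 2) = (2 * j)%N.
Proof. lia. Qed.

Lemma double_predn (j : nat) : 2 * j.+1%:Z - 1 = (2 * j).+1%N.
Proof. lia. Qed.

(** * Specialisation to the generating functions *)

Section GeneratingFunctions.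
                                                                               
                                                                  
Variable K : numFieldType.
Hypothesis dominated_cvg : forall (a : nat -> K) (c t : K), 0 <= t < 1 ->
  (forall n, `|a n| <= c * t ^+ n) -> cvgn (series a).

Lemma infprod_shift (a f : nat -> K) (l : K) : (forall j, a j.+1 = f j) ->
  l != 0 -> (fun N => \prod_(i < N) f i) @ \oo --> l -> infprod_cvg a /\ infprod a = l.
Proof.
move=> af l0 fl.
have al : (fun N => \prod_(1 <= i < N.+1) a i) @ \oo --> l.
  have -> : (fun N => \prod_(1 <= i < N.+1) a i) = (fun N => \prod_(i < N) f i).
    by apply/funext => N; rewrite big_add1 big_mkord; apply: eq_bigr => i _.
  by [].
have e : infprod a = l by apply: cvg_lim al.
by split=> //; split; [exact: cvgP al | rewrite e].
Qed.

Lemma infprod_shift_sqr (a f : nat -> K) (l : K) : (forall j, a j.+1 = f j ^+ 2) ->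
  l != 0 -> (fun N => \prod_(i < N) f i) @ \oo --> l ->
  infprod_cvg a /\ infprod a = l ^+ 2.
Proof.
move=> af l0 cf; apply: (infprod_shift af); first by rewrite expf_neq0.
have -> : (fun N => \prod_(i < N) f i ^+ 2)
    = (fun N => \prod_(i < N) f i * \prod_(i < N) f i).
  by apply/funext => N; rewrite prodrXl expr2.
by rewrite expr2; exact: (cvgM cf).
Qed.

Lemma series_scale (a b : nat -> K) (c l : K) : (forall n, a n = c * b n) ->
  series b @ \oo --> l -> series a @ \oo --> c * l.
Proof.
move=> ab bl; have -> : series a = (fun n => c * series b n).
  by apply/funext => n; rewrite /series /= mulr_sumr; apply: eq_bigr => i _.
exact: cvgMl_tmp.
Qed.

(** Completeness of [K] enters only through [dominated_cvg], which [cvg_series_dominated] supplies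
    for the complex numbers. All products are limits of (1 + z p^i)-products given by
    [cvg_qprod]. *)
Lemma generating_functions_complete (F : finFieldType) (delta : F) (u : K)
    (hq : odd #|F|)
    (hdelta : forall x : F, x ^+ 2 != delta)
    (hu : `|u| < 1 / #|F|%:R) :
  let q : K := #|F|%:R in
  let A (i : nat) := (1 + u / q ^ (2 * (i%:Z - 1))) ^+ 2 in
  let B (i : nat) := 1 - u ^+ 2 / q ^ (2 * (i%:Z - 2)) in
  let A' (i : nat) := (1 + u / q ^ (2 * i%:Z - 1)) ^+ 2 in
  let B' (i : nat) := 1 - u ^+ 2 / q ^ (2 * (i%:Z - 1)) in
  let A'' (i : nat) := (1 + u / q ^ (2 * i%:Z)) ^+ 2 in
  let B'' (i : nat) := 1 - u ^+ 2 / q ^ (2 * i%:Z) in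
  [/\ infprod_cvg A /\ infprod_cvg B,
      infprod_cvg A' /\ infprod_cvg B',
      infprod_cvg A'' /\ infprod_cvg B'',
      forall s : sign,
        sums_to (even_term s delta u)
          (1 / 2 * (infprod A / infprod B
                    + sign_val K s * (infprod A' / infprod B'))) &
      sums_to (odd_term F u)
        (1 / 2 * (1 / (1 - u)) * (infprod A'' / infprod B''))].
Proof.
move=> q A B A' B' A'' B''.
have q3 : 3 <= q.
  rewrite ler_nat; have := card_finNzRing_gt1 F; move: hq.
  by case: #|F| => [|[|[|]]].
have q_gt0 : 0 < q by apply: lt_le_trans q3; rewrite ltr0n.
have q0 : q != 0 by rewrite gt_eqF.
have q_ge1 : 1 <= q by apply: le_trans q3; rewrite ler1n.
(* r bounds all theta arguments uq, u and u/q, and is below 1 by the assumption on u; s is the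
   midpoint of r and 1. *)
pose r : K := `|u * q|; pose s : K := (1 + r) / 2; pose p : K := q ^- 2.
have r0 : 0 <= r by exact: normr_ge0.
have rE : r = `|u| * q by rewrite /r normrM (ger0_norm (ltW q_gt0)).
have r1 : r < 1 by rewrite rE -ltr_pdivlMr.
have r_lt_s : r < s by rewrite /s ltr_pdivlMr ?ltr0n // mulr_natr mulr2n ltrD2r.
have s_lt1 : s < 1.
  by rewrite /s ltr_pdivrMr ?ltr0n // mul1r [ltRHS](_ : _ = 1 + 1) // ltrD2l.
have div_le z : `|z / q| <= `|z|.
  by rewrite normrM normfV (ger0_norm (ltW q_gt0)) ler_pdivrMr // ler_peMr.
have ur : `|u| <= r by rewrite rE ler_peMr.
have u1r : `|u / q| <= r by apply: le_trans ur.
have u2r : `|u / q / q| <= r by apply: le_trans u1r.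
have uqr : `|u * q| <= r by [].
have sq_le z : `|z| <= r -> `|- (z ^+ 2)| <= r.
  move=> zr; rewrite normrN normrX expr2; apply: le_trans (zr).
  by rewrite ler_piMl // (le_trans zr) ?ltW.
have qprod := cvg_qprod q3 r0 r_lt_s s_lt1 dominated_cvg.
have [e0 e0n ce0] := qprod _ ur.
have [e1 e1n ce1] := qprod _ u1r.
have [e2 e2n ce2] := qprod _ u2r.
have [b0 b0n cb0] := qprod _ (sq_le _ uqr).
have [b1 b1n cb1] := qprod _ (sq_le _ ur).
have [b2 b2n cb2] := qprod _ (sq_le _ u1r).
have p_exprz j (z : int) : z = (2 * j)%N -> (q ^ z)^-1 = p ^+ j.
  by move=> ->; rewrite /p -exprnP exprM exprVn.
have subE (z x : K) n : 1 + - (z ^+ 2) * x ^+ n = 1 - z ^+ 2 * x ^+ n by rewrite mulNr.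
have [cA eA] : infprod_cvg A /\ infprod A = e0 ^+ 2.
  apply: (@infprod_shift_sqr _ (fun i => 1 + u * p ^+ i) _ _ _ ce0) => // j.
  by rewrite /A (p_exprz j _ (double_pred j)).
have [cB eB] : infprod_cvg B /\ infprod B = b0.
  apply: (@infprod_shift _ (fun i => 1 + - ((u * q) ^+ 2) * p ^+ i) _ _ _ cb0) => // j.
  rewrite /B subE -/p; case: j => [|j].
    (* The first factor has the negative exponent -2, so it is 1 - u^2 q^2. *)
    by rewrite expr0 mulr1 exprMn (_ : 2 * (1%:Z - 2) = - 2%:Z) // -exprnN invrK.
  rewrite (p_exprz j _ (double_pred2 j)).
  by rewrite [p ^+ j.+1]exprS mulrA exprMn /p mulfK // expf_neq0.
have [cA' eA'] : infprod_cvg A' /\ infprod A' = e1 ^+ 2.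
  apply: (@infprod_shift_sqr _ (fun i => 1 + u / q * p ^+ i) _ _ _ ce1) => // j.
  rewrite /A' double_predn.
  by rewrite -exprnP [q ^+ (2 * j).+1]exprS invfM mulrA exprM -exprVn.
have [cB' eB'] : infprod_cvg B' /\ infprod B' = b1.
  apply: (@infprod_shift _ (fun i => 1 + - (u ^+ 2) * p ^+ i) _ _ _ cb1) => // j.
  by rewrite /B' subE (p_exprz j _ (double_pred j)).
have [cA'' eA''] : infprod_cvg A'' /\ infprod A'' = e2 ^+ 2.
  apply: (@infprod_shift_sqr _ (fun i => 1 + u / q / q * p ^+ i) _ _ _ ce2) => // j.
  rewrite /A'' (p_exprz j.+1 _ erefl) [p ^+ j.+1]exprS; congr ((1 + _) ^+ 2).
  by rewrite mulrA; congr (_ * _); rewrite /p; field.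
have [cB'' eB''] : infprod_cvg B'' /\ infprod B'' = b2.
  apply: (@infprod_shift _ (fun i => 1 + - ((u / q) ^+ 2) * p ^+ i) _ _ _ cb2) => // j.
  rewrite /B'' subE (p_exprz j.+1 _ erefl) [p ^+ j.+1]exprS mulrA; congr (1 - _ * _).
  by rewrite /p; field.
split=> // [s'|].
  rewrite eA eB eA' eB'.
  apply: (series_scale (even_termE hq hdelta s' u)).
  have t0 : series (theta_term q (u * q) (u * q)) @ \oo --> e0 ^+ 2 / b0.
    rewrite expr2; apply: (theta_product q3 r0 r_lt_s s_lt1 dominated_cvg) => //.
    - by rewrite mulfK.
    - by rewrite mulfK.
    - by move: cb0; rewrite expr2; under eq_fun => N do under eq_bigr => i _ do rewrite mulNr.
  have t1 : series (theta_term q u u) @ \oo --> e1 ^+ 2 / b1.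
    rewrite expr2; apply: (theta_product q3 r0 r_lt_s s_lt1 dominated_cvg) => //.
    by move: cb1; rewrite expr2; under eq_fun => N do under eq_bigr => i _ do rewrite mulNr.
  have -> : series (fun n => theta_term q (u * q) (u * q) n + sign_val K s' * theta_term q u u n)
    = series (theta_term q (u * q) (u * q))
      \+ series (fun n => sign_val K s' * theta_term q u u n).
    by apply/funext => n; rewrite /series /= big_split.
  apply: cvgD t0 _; exact: series_scale (fun n => erefl) t1.
rewrite eA'' eB''.
have u1 : `|u| < 1 by apply: le_lt_trans ur r1.
have u_neq1 : 1 - u != 0.
  by rewrite subr_eq0; apply: contraTneq u1 => <-; rewrite normr1 ltxx.
have u_neqN1 : 1 + u != 0.
  by rewrite addr_eq0; apply: contraTneq u1 => e; rewrite -[u]opprK -e normrN normr1 ltxx.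
(* The products for (A, B) = (uq, u/q) are not symmetric: the one for uq has the extra factor 1 + u
   and the denominator the extra factor 1 - u^2, whose quotient is 1 / (1 - u). *)
have -> : 1 / 2 * (1 / (1 - u)) * (e2 ^+ 2 / b2)
  = 1 / 2 * ((1 + u) * e2 * e2 / ((1 - u ^+ 2) * b2)).
  have -> : 1 - u ^+ 2 = (1 - u) * (1 + u) by ring.
  by field; rewrite u_neq1 u_neqN1 b2n.
apply: (series_scale (odd_termE hq hdelta u)).
apply: (theta_product q3 r0 r_lt_s s_lt1 dominated_cvg) => //.
- rewrite mulf_neq0 // -[u ^+ 2]mul1r.
  have -> : 1 - 1 * u ^+ 2 = (1 - u) * (1 + u) by ring.
  by rewrite mulf_neq0.
- rewrite mulfK //; apply: cvg_qprod_shift; rewrite -/p.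
  by have -> : u * p = u / q / q by rewrite /p; field.
rewrite (_ : (fun N => _) = (fun N => \prod_(i < N) (1 + - u ^+ 2 * p ^+ i))); last first.
  apply/funext => N; apply: eq_bigr => i _.
  by rewrite mulNr; congr (1 - _ * _); field.
rewrite -[1 - u ^+ 2]/(1 + - u ^+ 2); apply: cvg_qprod_shift.
by have -> : - u ^+ 2 * p = - (u / q) ^+ 2 by rewrite /p; field.
Qed.

End GeneratingFunctions.

Theorem theorem6p1 (R : realType) (F : finFieldType) (delta : F) (u : R[i])
    (hq : odd #|F|)
    (hdelta : forall x : F, x ^+ 2 != delta)
    (hu : `|u| < 1 / #|F|%:R) :
  let q : R[i] := #|F|%:R in
  let A (i : nat) := (1 + u / q ^ (2 * (i%:Z - 1))) ^+ 2 in
  let B (i : nat) := 1 - u ^+ 2 / q ^ (2 * (i%:Z - 2)) in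
  let A' (i : nat) := (1 + u / q ^ (2 * i%:Z - 1)) ^+ 2 in
  let B' (i : nat) := 1 - u ^+ 2 / q ^ (2 * (i%:Z - 1)) in
  let A'' (i : nat) := (1 + u / q ^ (2 * i%:Z)) ^+ 2 in
  let B'' (i : nat) := 1 - u ^+ 2 / q ^ (2 * i%:Z) in
  [/\ infprod_cvg A /\ infprod_cvg B,
      infprod_cvg A' /\ infprod_cvg B',
      infprod_cvg A'' /\ infprod_cvg B'',
      forall s : sign,
        sums_to (even_term s delta u)
          (1 / 2 * (infprod A / infprod B
                    + sign_val R[i] s * (infprod A' / infprod B'))) &
      sums_to (odd_term F u)
        (1 / 2 * (1 / (1 - u)) * (infprod A'' / infprod B''))].
Proof.
exact: (generating_functions_complete (@cvg_series_dominated R)).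
Qed.
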